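(* Let $\lambda_1,\lambda_2,\lambda_3\in\mathbb{C}$ be such that $\sum_{i\in I}\lambda_i\notin\frac12\mathbb{Z}_{\ge0}$ for every nonempty $I\subseteq\{1,2,3\}$. Let $\lambda_{13},\lambda_{23},\lambda_{123}$ be such that $\lambda_1+\lambda_3-\lambda_{13}$, $\lambda_2+\lambda_3-\lambda_{23}$, $\lambda_{13}+\lambda_2-\lambda_{123}$, $\lambda_1+\lambda_{23}-\lambda_{123}\in\mathbb{Z}_{\ge0}$, and put $C_I=\lambda_I(\lambda_I+1)$ for each index $I$. Then $$\sum_\alpha(-1)^\alpha q^{-\alpha(\alpha+1)}\begin{Bmatrix}\lambda_1&\lambda_2&\alpha\\ \lambda_3&\lambda_{123}&\lambda_{23}\end{Bmatrix}_q\begin{Bmatrix}\lambda_3&\lambda_1&\lambda_{13}\\ \lambda_2&\lambda_{123}&\alpha\end{Bmatrix}_q$$ $$=(-1)^{\lambda_1+\lambda_2+\lambda_3+\lambda_{123}-\lambda_{13}-\lambda_{23}}q^{C_{13}+C_{23}-C_1-C_2-C_3-C_{123}}\begin{Bmatrix}\lambda_1&\lambda_3&\lambda_{13}\\ \lambda_2&\lambda_{123}&\lambda_{23}\end{Bmatrix}_q,$$ where the sum is over $\alpha=\lambda_1+\lambda_2-j$, $j=0,1,\ldots,\lambda_1+\lambda_2+\lambda_3-\lambda_{123}$.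
   Context: Notation: $q=e^{h/2}$ with $h\in\mathbb{C}$, $q^x:=e^{hx/2}$, $(-1)^x:=e^{i\pi x}$ for $x\in\mathbb{C}$, $[x]_q=\frac{q^x-q^{-x}}{q-q^{-1}}$, $[n]_q!=\prod_{s=1}^n[s]_q$, $[0]_q!=1$. The parameter $q$ is generic: $[x]_q\neq0$ for every nonzero $x\in\mathbb{Z}+2\mathbb{Z}\lambda_1+2\mathbb{Z}\lambda_2+2\mathbb{Z}\lambda_3$. Terms with $[n]_q!$, $n$ a negative integer, in the denominator are omitted; empty products equal $1$. For $\mu\notin\frac12\mathbb{Z}_{\ge0}$ the Verma module $M_\mu$ of $U_q(\mathfrak{sl}_2)$ has basis $e^\mu_a$, $a\in\mu-\mathbb{Z}_{\ge0}$, with $Ke^\mu_a=q^{2a}e^\mu_a$, $Ee^\mu_a=[\mu-a]_qe^\mu_{a+1}$, $Fe^\mu_a=[\mu+a]_qe^\mu_{a-1}$; the coproduct is $\Delta E=E\otimes K+1\otimes E$, $\Delta F=F\otimes1+K^{-1}\otimes F$, $\Delta K=K\otimes K$. For $\mu=\mu_1+\mu_2-J$, $J\in\mathbb{Z}_{\ge0}$, the $q3j$-symbols $$\begin{bmatrix}\mu_1&\mu_2&\mu\\ a_1&a_2&a\end{bmatrix}^\psi_q=(-1)^{\frac J2+\mu_1-a_1}q^{(\mu_2^2-a_2^2)-(\mu^2-a^2)-(\mu_1-a_1)}\frac{[\mu-a]_q!\,\Delta(\mu_1,\mu_2,\mu)}{\prod_{j=1}^{\mu-a}[\mu+a+j]_q}\sum_{z+w=\mu-a}(-1)^zq^{z(\mu+a+1)}\frac{\prod_{j=1}^z[\mu_1+a_1+j]_q\prod_{j=1}^w[\mu_2+a_2+j]_q}{[z]_q![w]_q![\mu_1-a_1-z]_q![\mu_2-a_2-w]_q!}$$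 ($z,w\in\mathbb{Z}_{\ge0}$, $a=a_1+a_2$; zero otherwise) are the matrix coefficients of a module embedding $M_\mu\hookrightarrow M_{\mu_1}\otimes M_{\mu_2}$. Here $\Delta(\mu_1,\mu_2,\mu)=\Big([J]_q!\prod_{j=0}^{J-1}\frac{[2\mu_1-j]_q[2\mu_2-j]_q}{[2\mu+2+j]_q}\Big)^{1/2}$ with square roots fixed once and for all so that $\Delta(\mu_1,\mu_2,\mu)=\Delta(\mu_2,\mu_1,\mu)$. $q6j$-symbols: for an ordered triple $(\mu_1,\mu_2,\mu_3)$ of weights define in $M_{\mu_1}\otimes M_{\mu_2}\otimes M_{\mu_3}$ $$e^{\mu_{12},\mu}_a=\sum_{a_1+a_2+a_3=a}\begin{bmatrix}\mu_{12}&\mu_3&\mu\\ a_1+a_2&a_3&a\end{bmatrix}^\psi_q\begin{bmatrix}\mu_1&\mu_2&\mu_{12}\\ a_1&a_2&a_1+a_2\end{bmatrix}^\psi_qe^{\mu_1}_{a_1}\otimes e^{\mu_2}_{a_2}\otimes e^{\mu_3}_{a_3},$$ $$e^{\mu_{23},\mu}_a=\sum_{a_1+a_2+a_3=a}\begin{bmatrix}\mu_1&\mu_{23}&\mu\\ a_1&a_2+a_3&a\end{bmatrix}^\psi_q\begin{bmatrix}\mu_2&\mu_3&\mu_{23}\\ a_2&a_3&a_2+a_3\end{bmatrix}^\psi_qe^{\mu_1}_{a_1}\otimes e^{\mu_2}_{a_2}\otimes e^{\mu_3}_{a_3}$$ ($3j$-symbols being $0$ when a weight does not occur in the corresponding module).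 For $\mu_1+\mu_2-\mu_{12},\mu_{12}+\mu_3-\mu\in\mathbb{Z}_{\ge0}$, the $q6j$-symbols are the coefficients (independent of $a$) in $$e^{\mu_{12},\mu}_a=\sum_{\mu_{23}}\begin{Bmatrix}\mu_1&\mu_2&\mu_{12}\\ \mu_3&\mu&\mu_{23}\end{Bmatrix}_qe^{\mu_{23},\mu}_a,$$ the sum being over $\mu_{23}$ with $\mu_2+\mu_3-\mu_{23},\ \mu_1+\mu_{23}-\mu\in\mathbb{Z}_{\ge0}$. *)

(* Defs.v *)
From mathcomp Require Import all_boot all_order all_algebra.
From mathcomp Require Import complex.
From mathcomp Require Import all_classical all_reals all_analysis.

Set Implicit Arguments.
Unset Strict Implicit.
Unset Printing Implicit Defensive.

Import Order.TTheory GRing.Theory Num.Theory.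
Local Open Scope classical_set_scope.
Local Open Scope complex_scope.
Local Open Scope ring_scope.

Section QuantumNumbers.
Variable R : realType.
Local Notation C := R[i].

Definition cexp (z : C) : C :=
  (expR (complex.Re z))%:C * (cos (complex.Im z) +i* sin (complex.Im z)).

(* (-1)^x := e^(i pi x), for complex x *)
Definition m1pow (x : C) : C := cexp ((0 +i* pi) * x).

Definition isnat (x : C) : bool :=
  (complex.Im x == 0) && (complex.Re x \is a Num.nat).

(* The natural number n such that x = n, meaningful only if [isnat x]. *)
Definition natval (x : C) : nat := Num.truncn (complex.Re x).

Definition half_nat (x : C) : Prop := exists n : nat, x = n%:R / 2.

Definition casimir (x : C) : C := x * (x + 1).

(* Everything below depends on q = e^(h/2) through the chosen logarithm h. *)
Variable h : C.

Definition qpow (x : C) : C := cexp (h * x / 2).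

Definition qnum (x : C) : C :=
  (qpow x - qpow (- x)) / (qpow 1 - qpow (- 1)).

Definition qfact (n : nat) : C := \prod_(1 <= s < n.+1) qnum s%:R.

(* Since division by 0 yields 0, the instance x = 1 also excludes q^2 = 1. *)
Definition q_generic (l1 l2 l3 : C) : Prop :=
  forall n n1 n2 n3 : int,
    let x := n%:~R + 2 * n1%:~R * l1 + 2 * n2%:~R * l2 + 2 * n3%:~R * l3 in
    x != 0 -> qnum x != 0.

Definition triangle_sq (mu1 mu2 mu : C) : C :=
  let J := natval (mu1 + mu2 - mu) in
  qfact J * \prod_(0 <= j < J)
    (qnum (2 * mu1 - j%:R) * qnum (2 * mu2 - j%:R) / qnum (2 * mu + 2 + j%:R)).

(* [Delta] is a choice, once and for all, of the square roots
   Delta(mu1, mu2, mu), symmetric in mu1 and mu2. *)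
Definition triangle_root (Delta : C -> C -> C -> C) : Prop :=
  forall mu1 mu2 mu : C, isnat (mu1 + mu2 - mu) ->
    Delta mu1 mu2 mu ^+ 2 = triangle_sq mu1 mu2 mu /\
    Delta mu1 mu2 mu = Delta mu2 mu1 mu.

Variable Delta : C -> C -> C -> C.

(* The q3j-symbol [ mu1 mu2 mu ; a1 a2 a ]; the terms that are left out of the
   sum are those with the q-factorial of a negative integer in the
   denominator. *)
Definition q3j (mu1 mu2 mu a1 a2 a : C) : C :=
  let k1 := natval (mu1 - a1) in
  let k2 := natval (mu2 - a2) in
  let k := natval (mu - a) in
  if [&& isnat (mu1 + mu2 - mu), isnat (mu1 - a1), isnat (mu2 - a2),
         isnat (mu - a) & a == a1 + a2] then
    m1pow ((mu1 + mu2 - mu) / 2 + mu1 - a1)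
    * qpow ((mu2 ^+ 2 - a2 ^+ 2) - (mu ^+ 2 - a ^+ 2) - (mu1 - a1))
    * (qfact k * Delta mu1 mu2 mu
       / \prod_(1 <= j < k.+1) qnum (mu + a + j%:R))
    * \sum_(0 <= z < k.+1 | (z <= k1)%N && (k - z <= k2)%N)
        let w := (k - z)%N in
        (-1) ^+ z * qpow (z%:R * (mu + a + 1))
        * (\prod_(1 <= j < z.+1) qnum (mu1 + a1 + j%:R)
           * \prod_(1 <= j < w.+1) qnum (mu2 + a2 + j%:R))
        / (qfact z * qfact w * qfact (k1 - z) * qfact (k2 - w))
  else 0.

(* Vectors of the threefold tensor product of Verma modules are represented by
   their coordinates: [e12 .. a a1 a2 a3] is the coefficient of the vector
   e_a^(mu12, mu) on the basis vector e_a1 (x) e_a2 (x) e_a3, and similarly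
   for [e23]. *)
Definition e12 (mu1 mu2 mu3 mu12 mu a : C) (a1 a2 a3 : C) : C :=
  if a1 + a2 + a3 == a then
    q3j mu12 mu3 mu (a1 + a2) a3 a * q3j mu1 mu2 mu12 a1 a2 (a1 + a2)
  else 0.

Definition e23 (mu1 mu2 mu3 mu23 mu a : C) (a1 a2 a3 : C) : C :=
  if a1 + a2 + a3 == a then
    q3j mu1 mu23 mu a1 (a2 + a3) a * q3j mu2 mu3 mu23 a2 a3 (a2 + a3)
  else 0.

Definition adm23 (mu1 mu2 mu3 mu : C) : set C :=
  [set mu23 | isnat (mu2 + mu3 - mu23) /\ isnat (mu1 + mu23 - mu)].

(* The coefficients c do not depend on a. *)
Definition q6j_expansion (mu1 mu2 mu12 mu3 mu : C) (c : C -> C) : Prop :=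
  forall a : C, isnat (mu - a) -> forall a1 a2 a3 : C,
    e12 mu1 mu2 mu3 mu12 mu a a1 a2 a3 =
    \sum_(mu23 \in adm23 mu1 mu2 mu3 mu)
      c mu23 * e23 mu1 mu2 mu3 mu23 mu a a1 a2 a3.

(* The q6j-symbol { mu1 mu2 mu12 ; mu3 mu mu23 }: the coefficient of
   e_a^(mu23, mu) in the expansion of e_a^(mu12, mu) (0 if there is no such
   expansion). *)
Definition q6j (mu1 mu2 mu12 mu3 mu mu23 : C) : C :=
  xget 0 [set s | exists2 c : C -> C,
    q6j_expansion mu1 mu2 mu12 mu3 mu c & s = c mu23].

End QuantumNumbers.

(* Main.v *)
(** The Racah relation expresses that the braiding of M_3 past M_1 (x) M_2 is
  the braiding past M_1 followed by the braiding past M_2. No R-matrix is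
  needed: a singular vector of M_1 (x) M_2 (x) M_3 is determined by its
  coordinates on the vectors whose third component is the highest weight vector
  of M_3, and there the 3j-sums have a single term, so that exchanging two
  tensor factors multiplies coordinates by an explicit monomial times
  (-1)^J q^(C_mu - C_1 - C_2). Comparing the expansions of the three bracketings
  on these coordinates gives a relation with q^(alpha (alpha + 1)) in place of
  q^(- alpha (alpha + 1)).

  The coordinates whose second component is the highest weight vector show in
  the same way that reversing the three tensor factors acts by a scalar
  independent of the intermediate weight, so the 6j-matrices of (1, 2, 3) and
  (3, 2, 1) are inverse to each other. Multiplying the first relation, with 2
  and 3 exchanged, by an inverse 6j-matrix turns it into the theorem. *)

Require Import Defs.
From mathcomp Require Import all_boot all_order all_algebra.
From mathcomp Require Import ring zify.
From mathcomp Require Import complex.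
From mathcomp Require Import all_classical all_reals all_analysis.

Set Implicit Arguments.
Unset Strict Implicit.
Unset Printing Implicit Defensive.

Import Order.TTheory GRing.Theory Num.Theory.
Local Open Scope complex_scope.
Local Open Scope ring_scope.

(** * Complex exponentials, powers of -1, and natural numbers inside C *)

Section Exponential.
Variable R : realType.
Local Notation C := R[i].

Lemma cexpD (x y : C) : cexp (x + y) = cexp x * cexp y.
Proof.
case: x y => a b [c d]; rewrite /cexp /= expRD cosD sinD.
by apply/eqP; rewrite eq_complex /=; apply/andP; split; apply/eqP; ring.
Qed.

Lemma cexp0 : cexp 0 = 1 :> C.
Proof. by rewrite /cexp /= expR0 cos0 sin0 mul1r. Qed.

Lemma m1powD (x y : C) : m1pow (x + y) = m1pow x * m1pow y.
Proof. by rewrite /m1pow mulrDr cexpD. Qed.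

Lemma m1pow_nat (n : nat) : m1pow n%:R = (-1) ^+ n :> C.
Proof.
elim: n => [|n IH]; first by rewrite /m1pow mulr0 cexp0.
rewrite -addn1 natrD m1powD IH addn1 exprSr; congr (_ * _).
rewrite /m1pow /cexp mulr1 /= expR0 cospi sinpi mul1r.
by apply/eqP; rewrite eq_complex /= !oppr0 !eqxx.
Qed.

Lemma m1pow_neq0 (x : C) : m1pow x != 0.
Proof.
apply: contra_neq (oner_neq0 C) => x0.
by have := @m1pow_nat 0; rewrite -[X in m1pow X](subrr x) m1powD x0 mul0r => /esym.
Qed.

Lemma isnatP (x : C) : reflect (exists n : nat, x = n%:R) (isnat x).
Proof.
apply: (iffP andP) => [[/eqP Im0 /natrP [n Re_n]]|[n ->]].
  exists n; case: x Im0 Re_n => a b /= -> ->.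
  by apply/eqP; rewrite eq_complex raddfMn /= (raddfMn (@complex.Im R)) /= mul0rn !eqxx.
by rewrite raddfMn /= (raddfMn (@complex.Re R)) /= mul0rn eqxx natr_nat.
Qed.

Lemma isnat_nat (n : nat) : isnat (n%:R : C).
Proof. by apply/isnatP; exists n. Qed.

Lemma natval_nat (n : nat) : natval (n%:R : C) = n.
Proof. by rewrite /natval (raddfMn (@complex.Re R)) /= natrK. Qed.

Lemma isnatD (x y : C) : isnat x -> isnat y -> isnat (x + y).
Proof.
by move=> /isnatP [m ->] /isnatP [n ->]; rewrite -natrD isnat_nat.
Qed.

End Exponential.

(** * Triangular linear systems *)

Section TriangularSystem.
Variables (F : fieldType) (N : nat) (T : nat -> nat -> F).
Hypothesis Tdiag : forall n, (n <= N)%N -> T n n != 0.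
Hypothesis Tupper : forall n j, (n < j)%N -> T n j = 0.

(** In row [j] the entries beyond the diagonal vanish and the earlier unknowns are zero by strong
    induction, so only [d j * T j j] remains. *)
Lemma triangular_free (d : nat -> F) :
    (forall n, (n <= N)%N -> \sum_(j < N.+1) d j * T n j = 0) ->
  forall j, (j <= N)%N -> d j = 0.
Proof.
move=> dT j; elim/ltn_ind: j => j IH jN.
have jN' : (j < N.+1)%N by [].
have := dT j jN; rewrite (bigD1 (Ordinal jN')) //= big1 ?addr0 => [/eqP|i].
  by rewrite mulf_eq0 (negbTE (Tdiag jN)) orbF => /eqP.
rewrite -val_eqE /= neq_ltn => /orP [ij|ji]; last by rewrite Tupper ?mulr0.
by rewrite IH ?mul0r // (leq_trans _ jN) // ltnW.
Qed.

(** Forward substitution: the last row fixes the last unknown, and that unknown does not occur in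
    the earlier rows. *)
Lemma triangular_solve (b : nat -> F) :
  exists c : nat -> F,
    forall n, (n <= N)%N -> \sum_(j < N.+1) c j * T n j = b n.
Proof.
(* The strict bound lets the induction on the size start from the empty system. *)
suff [c cT] : exists c : nat -> F, forall n, (n < N.+1)%N ->
    \sum_(j < N.+1) c j * T n j = b n by exists c.
have Tdiag' n : (n < N.+1)%N -> T n n != 0 by exact: Tdiag.
elim: N.+1 Tdiag' => [|M IH] TM; first by exists (fun=> 0).
have [//|c cT] := IH _; first by move=> n nM; apply: TM; apply: ltnW.
exists (fun j => if j == M then (b M - \sum_(i < M) c i * T M i) / T M M else c j).
move=> n; rewrite big_ord_recr /= eqxx ltnS => nM.
have -> : \sum_(i < M) (if (i : nat) == M then
      (b M - \sum_(i0 < M) c i0 * T M i0) / T M M else c i) * T n i =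
    \sum_(i < M) c i * T n i.
  by apply: eq_bigr => i _; rewrite (ltn_eqF (ltn_ord i)).
move: nM; rewrite leq_eqVlt => /orP [/eqP ->|nM].
  by rewrite divfK ?TM // addrC subrK.
by rewrite cT // (Tupper nM) mulr0 addr0.
Qed.

End TriangularSystem.

(** * q-powers, q-numbers and q-factorials *)

Section Racah.
Variables (R : realType) (h : R[i]).
Local Notation C := R[i].
Local Notation qpow := (qpow h).
Local Notation qnum := (qnum h).
Local Notation qfact := (qfact h).

Lemma qpowD (x y : C) : qpow (x + y) = qpow x * qpow y.
Proof. by rewrite /Defs.qpow -cexpD; congr cexp; ring. Qed.

Lemma qpow0 : qpow 0 = 1.
Proof. by rewrite /Defs.qpow mulr0 mul0r cexp0. Qed.

Lemma qpow_neq0 (x : C) : qpow x != 0.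
Proof.
apply: contra_neq (oner_neq0 C) => x0.
by have := qpow0; rewrite -[X in qpow X](subrr x) qpowD x0 mul0r => /esym.
Qed.

Lemma qpowN (x : C) : qpow (- x) = (qpow x)^-1.
Proof.
by apply: (mulfI (qpow_neq0 x)); rewrite -qpowD subrr qpow0 divff ?qpow_neq0.
Qed.

Lemma qnum0 : qnum 0 = 0.
Proof. by rewrite /Defs.qnum oppr0 subrr mul0r. Qed.

Lemma qnumD (x y : C) : qnum (x + y) = qpow y * qnum x + qpow (- x) * qnum y.
Proof. by rewrite /Defs.qnum opprD !qpowD; ring. Qed.

(** This is the relation EF - FE = [2a] evaluated on the basis vector of weight [a] in the Verma
    module of highest weight [l]. *)
Lemma qnum_comm (l a : C) : qnum 1 != 0 ->
  qnum (l - a + 1) * qnum (l + a) = qnum (l + a + 1) * qnum (l - a) + qnum (2 * a).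
Proof.
(* Since the inverse of 0 is 0, [qnum 1 != 0] forces the common denominator of all q-numbers to be
   nonzero. *)
move=> q1; have d0 : qpow 1 - qpow (- 1) != 0.
  by apply: contraNneq q1 => d0; rewrite /Defs.qnum d0 invr0 mulr0.
have -> : 2 * a = a + a by ring.
move: d0; rewrite /Defs.qnum !(opprD, opprK, qpowD, qpowN) => d0.
have := mulf_neq0 (qpow_neq0 1) d0; rewrite mulrBr divff ?qpow_neq0 // => d1.
by field; rewrite !qpow_neq0 d1.
Qed.

Definition qrising (n : nat) (x : C) : C := \prod_(1 <= j < n.+1) qnum (x + j%:R).

Lemma qrising0 (x : C) : qrising 0 x = 1.
Proof. by rewrite /qrising big_nil. Qed.

Lemma qrisingS (n : nat) (x : C) :
  qrising n.+1 x = qnum (x + 1) * qrising n (x + 1).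
Proof.
rewrite /qrising big_nat_recl //; congr (_ * _); apply: eq_big_nat => j _.
by congr qnum; rewrite -addn1 natrD; ring.
Qed.

Lemma qfact0 : qfact 0 = 1.
Proof. by rewrite /Defs.qfact big_nil. Qed.

Lemma qfactS (n : nat) : qfact n.+1 = qfact n * qnum n.+1%:R.
Proof. by rewrite /Defs.qfact big_nat_recr. Qed.

Hypothesis qnat : forall n : nat, qnum n.+1%:R != 0.

Lemma qfact_neq0 (n : nat) : qfact n != 0.
Proof.
by elim: n => [|n IH]; rewrite ?qfact0 ?oner_eq0 // qfactS mulf_neq0.
Qed.

(** The sum inside a 3j-symbol, for [y1] = mu1 + a1, [y2] = mu2 + a2, [x] = mu + a. The reciprocals
    of [mu_i - a_i - z]! are left as arbitrary functions [r1], [r2], because F shifts their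
    index. *)
Definition q3sum (k : nat) (y1 y2 x : C) (r1 r2 : nat -> C) : C :=
  \sum_(z < k.+1) (-1) ^+ z * qpow (z%:R * (x + 1))
    * (qrising z y1 * qrising (k - z) y2) / (qfact z * qfact (k - z))
    * (r1 z * r2 (k - z)%N).

(** A Pascal-type recursion: with w = k + 1 - z, write [k + 1] = q^z [w] + q^(-w) [z]. Each part
    kills one end of the sum and cancels one factor of [z]! or [w]!. The F-equivariance of the
    3j-symbols reduces to it. *)
Lemma q3sumS (k : nat) (y1 y2 x : C) (r1 r2 : nat -> C) :
  qnum k.+1%:R * q3sum k.+1 y1 y2 (x - 1) r1 r2 =
  qnum (y2 + 1) * q3sum k y1 (y2 + 1) x r1 (r2 \o succn)
  - qpow (x - k%:R) * (qnum (y1 + 1) * q3sum k (y1 + 1) y2 x (r1 \o succn) r2).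
Proof.
pose t z := (-1) ^+ z * qpow (z%:R * (x - 1 + 1))
    * (qrising z y1 * qrising (k.+1 - z) y2) / (qfact z * qfact (k.+1 - z))
    * (r1 z * r2 (k.+1 - z)%N).
have -> : qnum k.+1%:R * q3sum k.+1 y1 y2 (x - 1) r1 r2 =
    \sum_(z < k.+2) qpow (- (k.+1 - z)%N%:R) * qnum z%:R * t z
    + \sum_(z < k.+2) qpow z%:R * qnum (k.+1 - z)%N%:R * t z.
  rewrite -big_split /q3sum mulr_sumr; apply: eq_bigr => z _ /=.
  rewrite -mulrDl; congr (_ * _).
  have /subnK {1}<- : (z <= k.+1)%N by rewrite -ltnS.
  by rewrite natrD qnumD addrC.
rewrite big_ord_recl qnum0 mulr0 mul0r add0r.
rewrite [X in _ + X]big_ord_recr /= subnn qnum0 mulr0 mul0r addr0 addrC.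
congr (_ + _).
  rewrite /q3sum mulr_sumr; apply: eq_bigr => z _ /=; rewrite /t.
  have zk : (z <= k)%N by rewrite -ltnS.
  rewrite subSn // qrisingS qfactS /= subrK.
  rewrite (_ : z%:R * (x + 1) = z%:R * x + z%:R); last by ring.
  by rewrite qpowD; field; rewrite ?qnat !qfact_neq0.
rewrite /q3sum mulrA -mulNr mulr_sumr; apply: eq_bigr => z _ /=.
rewrite /t /bump /= add1n subSS qrisingS qfactS subrK exprS.
have zk : (z <= k)%N by rewrite -ltnS.
rewrite natrB //.
have -> : qpow (- (k%:R - z%:R)) = qpow (x - k%:R) * qpow (z%:R * (x + 1))
    * qpow (- (z.+1%:R * x)).
  by rewrite -!qpowD -natr1; congr (Defs.qpow h _); ring.
rewrite qpowN; field.
by rewrite ?qnat !qfact_neq0 qpow_neq0.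
Qed.

(** * 3j-symbols as intertwiners of Verma modules *)

Variable Delta : C -> C -> C -> C.
Local Notation q3j := (q3j h Delta).

(* The weight x is generic enough for the Verma module M_x to be irreducible. *)
Definition verma_generic (x : C) := forall k : nat, qnum (2 * x - k%:R) != 0.

Lemma verma_generic_sub (x : C) (n : nat) :
  verma_generic x -> verma_generic (x - n%:R).
Proof.
move=> gx k; rewrite (_ : _ - _ = 2 * x - (n + n + k)%:R) //.
by rewrite !natrD; ring.
Qed.

Lemma qrising_neq0 (mu a : C) (k : nat) :
  verma_generic mu -> mu - a = k%:R -> qrising k (mu + a) != 0.
Proof.
move=> gmu ak; rewrite prodf_seq_neq0; apply/allP => j.
rewrite mem_index_iota => /andP [_ jk] /=.
rewrite (_ : _ + _ = 2 * mu - (k - j)%:R) //.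
by rewrite natrB // -ak; ring.
Qed.

(* The convention 1/[m]! = 0 for m < 0. *)
Definition qfact_inv (n z : nat) : C := if (z <= n)%N then (qfact (n - z))^-1 else 0.

(** The bounds on z and w by [n1] and [n2] move into the zeros of [qfact_inv], so the range of
    summation depends on [k] alone and [q3sumS] applies. *)
Lemma q3jE (mu1 mu2 mu a1 a2 a : C) (J n1 n2 k : nat) :
    mu1 + mu2 - mu = J%:R -> mu1 - a1 = n1%:R -> mu2 - a2 = n2%:R ->
    mu - a = k%:R -> a = a1 + a2 ->
  q3j mu1 mu2 mu a1 a2 a =
    m1pow (J%:R / 2 + n1%:R)
    * qpow ((mu2 ^+ 2 - a2 ^+ 2) - (mu ^+ 2 - a ^+ 2) - n1%:R)
    * (qfact k * Delta mu1 mu2 mu / qrising k (mu + a))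
    * q3sum k (mu1 + a1) (mu2 + a2) (mu + a) (qfact_inv n1) (qfact_inv n2).
Proof.
move=> EJ E1 E2 Ek Ea.
rewrite /Defs.q3j -[_ / 2 + mu1 - a1]addrA EJ E1 E2 Ek -Ea eqxx !isnat_nat /=.
rewrite !natval_nat; congr (_ * _).
rewrite big_mkcond big_mkord /q3sum; apply: eq_bigr => z _ /=.
rewrite /qfact_inv; case: ifP => [/andP [-> ->]|].
  by rewrite !invfM !mulrA.
by move/negbT; rewrite negb_and => /orP [] /negbTE ->; rewrite ?mul0r ?mulr0.
Qed.

Lemma q3j_out (mu1 mu2 mu a1 a2 a : C) :
  ~~ [&& isnat (mu1 + mu2 - mu), isnat (mu1 - a1), isnat (mu2 - a2),
         isnat (mu - a) & a == a1 + a2] ->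
  q3j mu1 mu2 mu a1 a2 a = 0.
Proof. by rewrite /Defs.q3j => /negbTE ->. Qed.

(* The action on coordinates: the arguments are shifted because
   E e_(a-1) = [mu - a + 1] e_a and F e_(a+1) = [mu + a + 1] e_a. *)
Definition opE (mu1 mu2 : C) (f : C -> C -> C) (a1 a2 : C) : C :=
  qnum (mu1 - a1 + 1) * qpow (2 * a2) * f (a1 - 1) a2
  + qnum (mu2 - a2 + 1) * f a1 (a2 - 1).

Definition opF (mu1 mu2 : C) (f : C -> C -> C) (a1 a2 : C) : C :=
  qnum (mu1 + a1 + 1) * f (a1 + 1) a2
  + qpow (- (2 * a1)) * qnum (mu2 + a2 + 1) * f a1 (a2 + 1).

(** The mixed terms of the two coproducts cancel; [qnum_comm] in each factor leaves q^(2 a2) [2 a1]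
    + q^(-2 a1) [2 a2], which is [2 a1 + 2 a2]. *)
Lemma opEF (mu1 mu2 : C) (f : C -> C -> C) (a1 a2 : C) :
  opE mu1 mu2 (opF mu1 mu2 f) a1 a2 =
  opF mu1 mu2 (opE mu1 mu2 f) a1 a2 + qnum (2 * (a1 + a2)) * f a1 a2.
Proof.
have q1 := qnat 0; rewrite /opE /opF !(subrK, addrK).
rewrite (_ : mu1 + (a1 - 1) + 1 = mu1 + a1); last by ring.
rewrite (_ : mu2 + (a2 - 1) + 1 = mu2 + a2); last by ring.
rewrite (_ : mu1 - (a1 + 1) + 1 = mu1 - a1); last by ring.
rewrite (_ : mu2 - (a2 + 1) + 1 = mu2 - a2); last by ring.
rewrite (_ : 2 * (a1 + a2) = 2 * a1 + 2 * a2); last by ring.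
rewrite (qnumD (2 * a1) (2 * a2)).
have -> : qpow (- (2 * (a1 - 1))) = qpow (- (2 * a1)) * qpow 2.
  by rewrite -qpowD; congr (Defs.qpow h _); ring.
have -> : qpow (2 * (a2 + 1)) = qpow (2 * a2) * qpow 2.
  by rewrite -qpowD; congr (Defs.qpow h _); ring.
have e1 := qnum_comm mu1 a1 q1; have e2 := qnum_comm mu2 a2 q1.
set A1 := qnum (mu1 - a1 + 1) in e1 *; set B1 := qnum (mu1 + a1) in e1 *.
set A2 := qnum (mu2 - a2 + 1) in e2 *; set B2 := qnum (mu2 + a2) in e2 *.
set q2 := qpow (2 * a2); set q2i := qpow (- (2 * a1)); set f0 := f a1 a2.
have -> x y : A1 * q2 * (B1 * f0 + x) + A2 * (y + q2i * B2 * f0) =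
  A1 * B1 * (q2 * f0) + A2 * B2 * (q2i * f0) + A1 * q2 * x + A2 * y by ring.
by rewrite e1 e2; ring.
Qed.

(** After the monomial prefactors are collected this is [q3sumS]. The condition on [a] excludes [a]
    = mu + 1, where the left side is zero while the right side involves the highest weight
    vector. *)
Lemma q3j_F (mu1 mu2 mu a1 a2 a : C) : verma_generic mu -> isnat (mu - a) ->
  opF mu1 mu2 (fun x y => q3j mu1 mu2 mu x y a) a1 a2 =
  qnum (mu + a) * q3j mu1 mu2 mu a1 a2 (a - 1).
Proof.
move=> gmu /isnatP [k Ek].
(* Away from the support of the right-hand symbol, both symbols on the left vanish too. *)
have all0 : ~~ [&& isnat (mu1 + mu2 - mu), isnat (mu1 - a1), isnat (mu2 - a2)
                 & a == a1 + a2 + 1] ->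
    opF mu1 mu2 (fun x y => q3j mu1 mu2 mu x y a) a1 a2 =
    qnum (mu + a) * q3j mu1 mu2 mu a1 a2 (a - 1).
  move=> H; rewrite /opF !q3j_out ?mulr0 ?addr0 //; apply: contra H.
  - by case/and5P => -> -> -> _ /eqP /(canRL (subrK 1)) ->; rewrite /= eqxx.
  - case/and5P => -> -> + _ /eqP ->; rewrite opprD addrA.
    move=> /isnatD /(_ (isnat_nat R 1)); rewrite subrK => -> /=.
    by rewrite addrA eqxx.
  - case/and5P => -> + -> _ /eqP ->; rewrite opprD addrA.
    move=> /isnatD /(_ (isnat_nat R 1)); rewrite subrK => -> /=.
    by rewrite addrAC eqxx.
have [|/all0 //] := boolP [&& isnat (mu1 + mu2 - mu), isnat (mu1 - a1),
  isnat (mu2 - a2) & a == a1 + a2 + 1].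
case/and4P => /isnatP [J EJ] /isnatP [n1 E1] /isnatP [n2 E2] /eqP Ea.
have Ek1 : mu - (a - 1) = k.+1%:R by rewrite -natr1 -Ek; ring.
have Ea1 : a - 1 = a1 + a2 by rewrite Ea addrK.
have nz : qnum (mu + a) != 0.
  by rewrite (_ : _ + _ = 2 * mu - k%:R) // -Ek; ring.
have rnz := qrising_neq0 gmu Ek.
pose pre := m1pow (J%:R / 2 + n1%:R)
    * qpow ((mu2 ^+ 2 - a2 ^+ 2) - (mu ^+ 2 - a ^+ 2) - n1%:R)
    * (qfact k * Delta mu1 mu2 mu / qrising k (mu + a)).
have T1 : q3j mu1 mu2 mu (a1 + 1) a2 a = - pre * qpow 1 *
    q3sum k (mu1 + a1 + 1) (mu2 + a2) (mu + a) (qfact_inv n1 \o succn) (qfact_inv n2).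
  (* For [n1] = 0 the weight a1 + 1 lies above mu1: the symbol is zero, and so is the sum, since
     [qfact_inv 0] vanishes at successors. *)
  case: n1 @pre E1 => [|n1] pre E1.
    rewrite q3j_out; last first.
      apply/negP => /and5P [_ + _ _ _]; rewrite opprD addrA E1 sub0r.
      case/isnatP => n /eqP; rewrite eq_sym -subr_eq0 opprK natr1.
      by rewrite pnatr_eq0.
    by rewrite /q3sum big1 ?mulr0 // => z _; rewrite /= /qfact_inv mul0r mulr0.
  have E1' : mu1 - (a1 + 1) = n1%:R by rewrite opprD addrA E1 -natr1 addrK.
  rewrite (q3jE EJ E1' E2 Ek); last by rewrite Ea; ring.
  rewrite /pre -(natr1 n1) (_ : J%:R / 2 + (n1%:R + 1) = J%:R / 2 + n1%:R + 1%:R); last by ring.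
  rewrite (m1powD _ 1%:R) m1pow_nat expr1.
  set d := mu2 ^+ 2 - a2 ^+ 2 - (mu ^+ 2 - a ^+ 2).
  have -> : qpow (d - n1%:R) = qpow (d - (n1%:R + 1)) * qpow 1.
    by rewrite -qpowD; congr (Defs.qpow h _); ring.
  have -> : q3sum k (mu1 + (a1 + 1)) (mu2 + a2) (mu + a) (qfact_inv n1) (qfact_inv n2) =
    q3sum k (mu1 + a1 + 1) (mu2 + a2) (mu + a) (qfact_inv n1.+1 \o succn) (qfact_inv n2).
    by rewrite addrA.
  by ring.
have T2 : q3j mu1 mu2 mu a1 (a2 + 1) a = pre * qpow (- (2 * a2 + 1)) *
    q3sum k (mu1 + a1) (mu2 + a2 + 1) (mu + a) (qfact_inv n1) (qfact_inv n2 \o succn).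
  clear T1; case: n2 E2 => [|n2] E2.
    rewrite q3j_out; last first.
      apply/negP => /and5P [_ _ + _ _]; rewrite opprD addrA E2 sub0r.
      case/isnatP => n /eqP; rewrite eq_sym -subr_eq0 opprK natr1.
      by rewrite pnatr_eq0.
    by rewrite /q3sum big1 ?mulr0 // => z _; rewrite /= /qfact_inv mulr0 mulr0.
  have E2' : mu2 - (a2 + 1) = n2%:R by rewrite opprD addrA E2 -natr1 addrK.
  rewrite (q3jE EJ E1 E2' Ek); last by rewrite Ea; ring.
  have -> : qpow (mu2 ^+ 2 - (a2 + 1) ^+ 2 - (mu ^+ 2 - a ^+ 2) - n1%:R) =
     qpow (mu2 ^+ 2 - a2 ^+ 2 - (mu ^+ 2 - a ^+ 2) - n1%:R) * qpow (- (2 * a2 + 1)).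
    by rewrite -qpowD; congr (Defs.qpow h _); ring.
  have -> : q3sum k (mu1 + a1) (mu2 + (a2 + 1)) (mu + a) (qfact_inv n1) (qfact_inv n2) =
    q3sum k (mu1 + a1) (mu2 + a2 + 1) (mu + a) (qfact_inv n1) (qfact_inv n2.+1 \o succn).
    by rewrite addrA.
  by rewrite /pre; ring.
rewrite /opF T1 T2 (q3jE EJ E1 E2 Ek1 Ea1).
have -> : qrising k.+1 (mu + (a - 1)) = qnum (mu + a) * qrising k (mu + a).
  by rewrite addrA qrisingS subrK.
have := q3sumS k (mu1 + a1) (mu2 + a2) (mu + a) (qfact_inv n1) (qfact_inv n2).
rewrite addrA qfactS => e.
set S1 := q3sum _ (mu1 + a1 + 1) _ _ _ _ in e *.
set S2 := q3sum _ _ (mu2 + a2 + 1) _ _ _ in e *.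
set S := q3sum k.+1 _ _ _ _ _ in e *.
have -> : qpow (mu2 ^+ 2 - a2 ^+ 2 - (mu ^+ 2 - (a - 1) ^+ 2) - n1%:R) =
   qpow (mu2 ^+ 2 - a2 ^+ 2 - (mu ^+ 2 - a ^+ 2) - n1%:R)
   * (qpow (- (2 * a1)) * qpow (- (2 * a2 + 1))).
  by rewrite -!qpowD; congr (Defs.qpow h _); rewrite Ea; ring.
have eq1 : qpow 1 = qpow (mu + a - k%:R) * (qpow (- (2 * a1)) * qpow (- (2 * a2 + 1))).
  by rewrite -!qpowD; congr (Defs.qpow h _); rewrite -Ek Ea; ring.
transitivity (pre * (qpow (- (2 * a1)) * qpow (- (2 * a2 + 1))) *
   (qnum (mu2 + a2 + 1) * S2 - qpow (mu + a - k%:R) * (qnum (mu1 + a1 + 1) * S1))).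
  by rewrite eq1; ring.
by rewrite -e /pre; field; rewrite nz rnz.
Qed.

(** A highest weight second component forces w = 0; in [q3sum_first] a highest weight first
    component forces z = 0. *)
Lemma q3sum_last (k : nat) (y1 y2 x : C) (r : nat -> C) :
  q3sum k y1 y2 x r (qfact_inv 0) =
  (-1) ^+ k * qpow (k%:R * (x + 1)) * qrising k y1 / qfact k * r k.
Proof.
rewrite /q3sum big_ord_recr /= big1 ?add0r => [|z _].
  by rewrite subnn qrising0 /qfact_inv /= qfact0 invr1 !mulr1.
by rewrite /qfact_inv leqn0 subn_eq0 leqNgt ltn_ord !mulr0.
Qed.

Lemma q3sum_first (k : nat) (y1 y2 x : C) (r : nat -> C) :
  q3sum k y1 y2 x (qfact_inv 0) r = qrising k y2 / qfact k * r k.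
Proof.
rewrite /q3sum big_ord_recl /= big1 ?addr0 => [|z _].
  by rewrite subn0 qrising0 /qfact_inv /= qfact0 invr1 mul0r qpow0 !mul1r.
by rewrite /qfact_inv /= mul0r mulr0.
Qed.

Lemma q3j_top (mu1 mu2 mu a1 a2 : C) (J n1 n2 : nat) :
    mu1 + mu2 - mu = J%:R -> mu1 - a1 = n1%:R -> mu2 - a2 = n2%:R ->
    mu = a1 + a2 ->
  q3j mu1 mu2 mu a1 a2 mu =
    m1pow (J%:R / 2 + n1%:R) * qpow (mu2 ^+ 2 - a2 ^+ 2 - n1%:R)
    * Delta mu1 mu2 mu / (qfact n1 * qfact n2).
Proof.
move=> EJ E1 E2 Ea; rewrite (q3jE (k := 0) EJ E1 E2) //; last by rewrite subrr.
rewrite subrr subr0 qfact0 qrising0 /q3sum big_ord1 /= !qrising0 qfact0.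
by rewrite /qfact_inv /= !subn0 mul0r qpow0 !invfM mulr1 invr1; ring.
Qed.

Lemma isnat_top (mu1 mu2 mu a1 a2 : C) : isnat (mu1 - a1) -> isnat (mu2 - a2) ->
  mu = a1 + a2 -> isnat (mu1 + mu2 - mu).
Proof. by move=> H1 H2 ->; rewrite opprD addrACA isnatD. Qed.

(** At [a] = mu each 3j-symbol is a single monomial, and the two contributions to E differ only by
    the sign that m1pow acquires when n1 grows by one. *)
Lemma q3j_top_singular (mu1 mu2 mu a1 a2 : C) :
  opE mu1 mu2 (fun x y => q3j mu1 mu2 mu x y mu) a1 a2 = 0.
Proof.
have [] := boolP [&& isnat (mu1 - a1), isnat (mu2 - a2) & mu == a1 + a2 - 1]; last first.
  move=> H; rewrite /opE.
  (* At a1 = mu1 + 1 the symbol at a1 - 1 can be nonzero, but its coefficient is [0]. *)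
  have [n1|n1] := eqVneq (mu1 - a1 + 1) 0.
    rewrite n1 qnum0 !mul0r add0r q3j_out ?mulr0 //.
    apply/negP => /and5P [_ /isnatP [n]]; move/eqP: n1; rewrite addr_eq0 => /eqP ->.
    by move/eqP; rewrite eq_sym -subr_eq0 opprK natr1 pnatr_eq0.
  have [n2|n2] := eqVneq (mu2 - a2 + 1) 0.
    rewrite n2 qnum0 !mul0r addr0 q3j_out ?mulr0 //.
    apply/negP => /and5P [_ _ /isnatP [n]]; move/eqP: n2; rewrite addr_eq0 => /eqP ->.
    by move/eqP; rewrite eq_sym -subr_eq0 opprK natr1 pnatr_eq0.
  have pred_nat (x : C) : x + 1 != 0 -> isnat (x + 1) -> isnat x.
    move=> x0 /isnatP [[|n] En]; first by rewrite En eqxx in x0.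
    by apply/isnatP; exists n; apply: (addIr 1); rewrite En natr1.
  rewrite !q3j_out ?mulr0 ?addr0 //; apply: contra H.
    case/and5P => _ -> + _ /eqP ->; rewrite opprD opprK addrA => /(pred_nat _ n2) ->.
    by rewrite /= addrA eqxx.
  case/and5P => _ + -> _ /eqP ->; rewrite opprD opprK addrA => /(pred_nat _ n1) ->.
  by rewrite /= addrAC eqxx.
case/and3P => i1 i2 /eqP Ea; rewrite /opE.
have /isnatP [J EJ] : isnat (mu1 + mu2 - mu).
  apply: (@isnat_top _ _ _ a1 (a2 - 1)) => //; last by rewrite Ea addrA.
  by rewrite opprB addrA addrAC isnatD // (isnat_nat R 1).
have [n1 E1] := isnatP _ i1; have [n2 E2] := isnatP _ i2.
have E1' : mu1 - (a1 - 1) = n1.+1%:R by rewrite -natr1 -E1; ring.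
have E2' : mu2 - (a2 - 1) = n2.+1%:R by rewrite -natr1 -E2; ring.
rewrite (q3j_top EJ E1' E2); last by rewrite Ea; ring.
rewrite (q3j_top EJ E1 E2'); last by rewrite Ea; ring.
rewrite E1 E2 !natr1 !qfactS.
rewrite -(natr1 n1) (addrA (J%:R / 2)) (m1powD _ 1%:R) m1pow_nat expr1 natr1.
have -> : qpow (mu2 ^+ 2 - (a2 - 1) ^+ 2 - n1%:R) =
  qpow (2 * a2) * qpow (mu2 ^+ 2 - a2 ^+ 2 - n1.+1%:R).
  by rewrite -qpowD -natr1; congr (Defs.qpow h _); ring.
by field; rewrite !qnat !qfact_neq0.
Qed.

(** Induction downwards from the singular vector: up to the nonzero factor [mu + a + 1] the vector
    of weight [a] is F applied to that of weight a + 1, and [opEF] moves E past F. *)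
Lemma q3j_E (mu1 mu2 mu a1 a2 a : C) : verma_generic mu ->
  opE mu1 mu2 (fun x y => q3j mu1 mu2 mu x y a) a1 a2 =
  qnum (mu - a) * q3j mu1 mu2 mu a1 a2 (a + 1).
Proof.
move=> gmu; have [/isnatP [k]|na] := boolP (isnat (mu - a)); last first.
  rewrite /opE !q3j_out ?mulr0 ?addr0 //; apply: contra na => /and5P [_ _ _] //.
  by move=> /isnatD /(_ (isnat_nat R 1)); rewrite opprD addrA subrK.
elim: k a a1 a2 => [|k IH] a a1 a2 Ek.
  by move/eqP: Ek; rewrite subr_eq0 => /eqP <-; rewrite q3j_top_singular subrr qnum0 mul0r.
have Ek' : mu - (a + 1) = k%:R by rewrite opprD addrA Ek -natr1 addrK.
have ik : isnat (mu - (a + 1)) by rewrite Ek' isnat_nat.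
have nz : qnum (mu + (a + 1)) != 0.
  by rewrite (_ : _ + _ = 2 * mu - k%:R) // -Ek'; ring.
have Fk x y : opF mu1 mu2 (fun x y => q3j mu1 mu2 mu x y (a + 1)) x y =
    qnum (mu + (a + 1)) * q3j mu1 mu2 mu x y a.
  by rewrite q3j_F // addrK.
apply: (mulfI nz).
have -> : qnum (mu + (a + 1)) * opE mu1 mu2 (fun x y => q3j mu1 mu2 mu x y a) a1 a2 =
    opE mu1 mu2 (opF mu1 mu2 (fun x y => q3j mu1 mu2 mu x y (a + 1))) a1 a2.
  by rewrite /opE !Fk; ring.
rewrite opEF.
have -> : opF mu1 mu2 (opE mu1 mu2 (fun x y => q3j mu1 mu2 mu x y (a + 1))) a1 a2 =
    qnum (mu - (a + 1)) * (qnum (mu + a + 2) * q3j mu1 mu2 mu a1 a2 (a + 1)).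
  (* For [k] = 0 the vector of weight a + 1 is already the top one, where [q3j_F] cannot be used at
     a + 2; the factor [mu - (a + 1)] = [0] settles this case. *)
  rewrite {1}/opF !IH //; case: k {IH} Ek Ek' ik => [|k] Ek Ek' ik.
    by rewrite Ek' qnum0; ring.
  have Ek'' : isnat (mu - (a + 1 + 1)).
    by apply/isnatP; exists k; rewrite opprD addrA Ek' -natr1 addrK.
  have := @q3j_F mu1 mu2 _ a1 a2 _ gmu Ek''.
  rewrite addrK (_ : mu + (a + 1 + 1) = mu + a + 2); last by ring.
  by move=> <-; rewrite /opF; ring.
have [<-|ne] := eqVneq (a + 1) (a1 + a2); last first.
  by rewrite (@q3j_out _ _ _ _ _ (a + 1)) ?mulr0 ?addr0 // (negbTE ne) !andbF.
have := qnum_comm mu (a + 1) (qnat 0).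
rewrite (_ : mu - (a + 1) + 1 = mu - a); last by ring.
rewrite (_ : mu + (a + 1) + 1 = mu + a + 2); last by ring.
move=> e; set X := q3j mu1 mu2 mu a1 a2 (a + 1).
transitivity ((qnum (mu + a + 2) * qnum (mu - (a + 1)) + qnum (2 * (a + 1))) * X).
  by ring.
by rewrite -e; ring.
Qed.

(** * Exchanging two tensor factors *)

Definition braid_phase (mu1 mu2 mu : C) : C :=
  (-1) ^+ natval (mu1 + mu2 - mu)
  * qpow (casimir mu - casimir mu1 - casimir mu2).

Lemma braid_phase_neq0 (mu1 mu2 mu : C) : braid_phase mu1 mu2 mu != 0.
Proof. by rewrite /braid_phase mulf_neq0 ?qpow_neq0 ?expf_neq0 ?oppr_eq0 ?oner_eq0. Qed.

Lemma braid_phaseC (mu1 mu2 mu : C) : braid_phase mu1 mu2 mu = braid_phase mu2 mu1 mu.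
Proof. by rewrite /braid_phase (addrC mu1); congr (_ * Defs.qpow h _); ring. Qed.

Hypothesis hDelta : triangle_root h Delta.

(** With a2 = mu2 both sums collapse to one term, by [q3sum_last] and [q3sum_first]. [braid_phase]
    is the eigenvalue of the braiding on the copy of [M_mu], and q^(-2 a1 mu2) is the inverse of the
    Cartan part of the R-matrix. *)
Lemma q3j_braid (mu1 mu2 mu a1 a : C) :
  q3j mu1 mu2 mu a1 mu2 a =
  braid_phase mu1 mu2 mu * qpow (- (2 * a1 * mu2)) * q3j mu2 mu1 mu mu2 a1 a.
Proof.
have isnat0 : isnat (mu2 - mu2) by rewrite subrr (isnat_nat R 0).
have [/and4P[+ i1 ik /eqP Ea]|H] := boolP [&& isnat (mu1 + mu2 - mu),
    isnat (mu1 - a1), isnat (mu - a) & a == a1 + mu2]; last first.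
  rewrite !q3j_out ?mulr0 //; apply: contra H; last by case/and5P => -> -> _ -> ->.
  by case/and5P; rewrite (addrC mu2 mu1) (addrC mu2 a1) => -> _ -> -> ->.
move=> iJ; case/isnatP: (iJ) => J EJ.
have [[n1 E1] [k Ek]] := (isnatP _ i1, isnatP _ ik).
have E2 : mu2 - mu2 = 0%:R by rewrite subrr.
have EJ' : mu2 + mu1 - mu = J%:R by rewrite (addrC mu2).
have Ea' : a = mu2 + a1 by rewrite (addrC mu2).
(* Hence the sign (-1)^n1 of the prefactor and the (-1)^k of the surviving term combine to
   (-1)^J. *)
have nk : n1 = (J + k)%N.
  by apply/eqP; rewrite -(eqr_nat C) natrD -E1 -EJ -Ek Ea; apply/eqP; ring.
rewrite (q3jE EJ E1 E2 Ek Ea) (q3jE EJ' E2 E1 Ek Ea').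
rewrite q3sum_last q3sum_first /braid_phase EJ natval_nat.
have [_ ->] := hDelta iJ.
rewrite addr0 m1powD m1pow_nat {1}nk exprD.
have sgnk : (-1) ^+ k * (-1) ^+ k = 1 :> C by rewrite -exprMn mulrNN mulr1 expr1n.
have -> : qpow (mu2 ^+ 2 - mu2 ^+ 2 - (mu ^+ 2 - a ^+ 2) - n1%:R) =
  qpow (casimir mu - casimir mu1 - casimir mu2) * qpow (- (2 * a1 * mu2))
  * qpow (mu1 ^+ 2 - a1 ^+ 2 - (mu ^+ 2 - a ^+ 2) - 0%:R)
  * qpow (- (k%:R * (mu + a + 1))).
  by rewrite -!qpowD /casimir; congr (Defs.qpow h _); rewrite -E1 -Ek Ea; ring.
rewrite (qpowN (k%:R * _)); set q := qpow (k%:R * _); have q0 : q != 0 by apply: qpow_neq0.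
set s := (-1) ^+ k in sgnk *; set D := Delta mu2 mu1 mu.
set A := (-1) ^+ J; set B := m1pow _; set P := qpow (_ - _ - _ - _).
set Q := qpow (casimir _ - _ - _); set T := qpow (- _); set X := (_ / qrising k (mu + a)).
transitivity (A * B * Q * T * P * X * (qrising k (mu1 + a1) / qfact k * qfact_inv n1 k)
   * (s * s) * (q^-1 * q)); first by ring.
by rewrite sgnk mulVf //; ring.
Qed.

(** At [a] = mu the sum has one term for every a1, a2, so neither component need be of highest
    weight. The sign is (-1)^(n1 + n2), with n1 + n2 = J. *)
Lemma q3j_top_flip (mu1 mu2 mu a1 a2 : C) :
  q3j mu1 mu2 mu a1 a2 mu =
  (-1) ^+ natval (mu1 + mu2 - mu)
  * qpow (casimir mu2 - casimir mu1 + casimir a1 - casimir a2)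
  * q3j mu2 mu1 mu a2 a1 mu.
Proof.
have [/and3P[i1 i2 /eqP Ea]|H] := boolP [&& isnat (mu1 - a1), isnat (mu2 - a2)
    & mu == a1 + a2]; last first.
  rewrite !q3j_out ?mulr0 //; apply: contra H; last by case/and5P => _ -> -> _ ->.
  by case/and5P; rewrite (addrC a1) => _ -> -> _ ->.
have iJ := isnat_top i1 i2 Ea; case/isnatP: (iJ) => J EJ.
have [[n1 E1] [n2 E2]] := (isnatP _ i1, isnatP _ i2).
have EJ' : mu2 + mu1 - mu = J%:R by rewrite (addrC mu2).
have nJ : J = (n1 + n2)%N.
  by apply/eqP; rewrite -(eqr_nat C) natrD -E1 -EJ -E2 Ea; apply/eqP; ring.
rewrite (q3j_top EJ E1 E2 Ea) (q3j_top EJ' E2 E1); last by rewrite Ea addrC.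
rewrite EJ natval_nat; have [_ ->] := hDelta iJ.
rewrite !m1powD !m1pow_nat [in (-1) ^+ J]nJ exprD.
have sgn2 : (-1) ^+ n2 * (-1) ^+ n2 = 1 :> C by rewrite -exprMn mulrNN mulr1 expr1n.
have -> : qpow (mu2 ^+ 2 - a2 ^+ 2 - n1%:R) =
  qpow (casimir mu2 - casimir mu1 + casimir a1 - casimir a2)
  * qpow (mu1 ^+ 2 - a1 ^+ 2 - n2%:R).
  by rewrite -!qpowD /casimir; congr (Defs.qpow h _); rewrite -E1 -E2; ring.
rewrite (mulrC (qfact n2)).
set s := (-1) ^+ n2 in sgn2 *; set X := qpow (_ - _ + _ - _); set Y := qpow (_ - _ - _).
set D := Delta _ _ _; set V := (_ * _)^-1; set B := m1pow _.
transitivity (B * (-1) ^+ n1 * (s * s) * X * Y * D * V); last by ring.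
by rewrite sgn2; ring.
Qed.

Lemma Delta_neq0 (mu1 mu2 mu : C) : isnat (mu1 + mu2 - mu) ->
    verma_generic mu1 -> verma_generic mu2 -> verma_generic (mu1 + mu2) ->
  Delta mu1 mu2 mu != 0.
Proof.
move=> iJ g1 g2 g12; have [Dsq _] := hDelta iJ; have [J EJ] := isnatP _ iJ.
suff : triangle_sq h mu1 mu2 mu != 0 by rewrite -Dsq expf_eq0.
rewrite /triangle_sq EJ natval_nat mulf_neq0 ?qfact_neq0 //.
rewrite prodf_seq_neq0; apply/allP => j; rewrite mem_index_iota /= => jJ.
apply: mulf_neq0; first exact: mulf_neq0 (g1 j) (g2 j).
apply: invr_neq0.
(* As [j < J], the subtraction of naturals is exact, and genericity of mu1 + mu2 covers the
   denominators. *)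
have -> : 2 * mu + 2 + j%:R = 2 * (mu1 + mu2) - (J + J - (j + 2))%:R; last by [].
rewrite natrB; last by lia.
by rewrite !natrD -EJ; ring.
Qed.

Lemma q3j_top_neq0 (mu1 mu2 mu a1 a2 : C) :
    isnat (mu1 - a1) -> isnat (mu2 - a2) -> mu = a1 + a2 ->
    verma_generic mu1 -> verma_generic mu2 -> verma_generic (mu1 + mu2) ->
  q3j mu1 mu2 mu a1 a2 mu != 0.
Proof.
move=> i1 i2 Ea g1 g2 g12.
have iJ := isnat_top i1 i2 Ea; case/isnatP: (iJ) => J EJ.
have [[n1 E1] [n2 E2]] := (isnatP _ i1, isnatP _ i2).
rewrite (q3j_top EJ E1 E2 Ea); apply: mulf_neq0; last first.
  by rewrite invr_neq0 // mulf_neq0 // qfact_neq0.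
apply: mulf_neq0; last exact: Delta_neq0.
exact: mulf_neq0 (m1pow_neq0 _) (qpow_neq0 _).
Qed.

(** * Coupled vectors in the threefold tensor product *)

Local Notation e12 := (e12 h Delta).
Local Notation e23 := (e23 h Delta).
Local Notation q6j := (q6j h Delta).

Lemma e12E (m1 m2 m3 m12 mu a a1 a2 a3 : C) :
  e12 m1 m2 m3 m12 mu a a1 a2 a3 =
  q3j m12 m3 mu (a1 + a2) a3 a * q3j m1 m2 m12 a1 a2 (a1 + a2).
Proof.
rewrite /Defs.e12; case: ifPn => // ne.
by rewrite q3j_out ?mul0r // [a == _]eq_sym (negbTE ne) !andbF.
Qed.

Lemma e23E (m1 m2 m3 m23 mu a a1 a2 a3 : C) :
  e23 m1 m2 m3 m23 mu a a1 a2 a3 =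
  q3j m1 m23 mu a1 (a2 + a3) a * q3j m2 m3 m23 a2 a3 (a2 + a3).
Proof.
rewrite /Defs.e23; case: ifPn => // ne.
by rewrite q3j_out ?mul0r // [a == _]eq_sym addrA (negbTE ne) !andbF.
Qed.

(** The iterated coproduct on coordinates: E acts as E K K + 1 E K + 1 1 E, and F in [opF3] as F 1 1
    + K^-1 F 1 + K^-1 K^-1 F. *)
Definition opE3 (m1 m2 m3 : C) (g : C -> C -> C -> C) (a1 a2 a3 : C) : C :=
  qnum (m1 - a1 + 1) * qpow (2 * (a2 + a3)) * g (a1 - 1) a2 a3
  + qnum (m2 - a2 + 1) * qpow (2 * a3) * g a1 (a2 - 1) a3
  + qnum (m3 - a3 + 1) * g a1 a2 (a3 - 1).

Definition opF3 (m1 m2 m3 : C) (g : C -> C -> C -> C) (a1 a2 a3 : C) : C :=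
  qnum (m1 + a1 + 1) * g (a1 + 1) a2 a3
  + qpow (- (2 * a1)) * qnum (m2 + a2 + 1) * g a1 (a2 + 1) a3
  + qpow (- (2 * (a1 + a2))) * qnum (m3 + a3 + 1) * g a1 a2 (a3 + 1).

(** A composite of intertwiners: the inner symbol turns E on the first two factors into E on
    [M_m12], and the outer symbol finishes. *)
Lemma e12_E (m1 m2 m3 m12 mu a a1 a2 a3 : C) :
    verma_generic m12 -> verma_generic mu ->
  opE3 m1 m2 m3 (e12 m1 m2 m3 m12 mu a) a1 a2 a3 =
  qnum (mu - a) * e12 m1 m2 m3 m12 mu (a + 1) a1 a2 a3.
Proof.
move=> g12 gmu; rewrite /opE3 !e12E [RHS]mulrA.
have := @q3j_E m12 m3 mu (a1 + a2) a3 a gmu; rewrite /opE => <-.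
have := @q3j_E m1 m2 m12 a1 a2 (a1 + a2 - 1) g12; rewrite /opE.
rewrite subrK (_ : m12 - (a1 + a2 - 1) = m12 - (a1 + a2) + 1); last by ring.
rewrite (_ : a1 - 1 + a2 = a1 + a2 - 1); last by ring.
rewrite (_ : a1 + (a2 - 1) = a1 + a2 - 1); last by ring.
rewrite (_ : 2 * (a2 + a3) = 2 * a2 + 2 * a3); last by ring.
rewrite qpowD => e.
set A := q3j m12 m3 mu (a1 + a2 - 1) a3 a; set q3 := qpow (2 * a3).
transitivity (q3 * A * (qnum (m12 - (a1 + a2) + 1) * q3j m1 m2 m12 a1 a2 (a1 + a2))
  + qnum (m3 - a3 + 1) * (q3j m12 m3 mu (a1 + a2) (a3 - 1) a
      * q3j m1 m2 m12 a1 a2 (a1 + a2))); last by ring.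
by rewrite -e; ring.
Qed.

Lemma e23_E (m1 m2 m3 m23 mu a a1 a2 a3 : C) :
    verma_generic m23 -> verma_generic mu ->
  opE3 m1 m2 m3 (e23 m1 m2 m3 m23 mu a) a1 a2 a3 =
  qnum (mu - a) * e23 m1 m2 m3 m23 mu (a + 1) a1 a2 a3.
Proof.
move=> g23 gmu; rewrite /opE3 !e23E [RHS]mulrA.
have := @q3j_E m1 m23 mu a1 (a2 + a3) a gmu; rewrite /opE => <-.
have := @q3j_E m2 m3 m23 a2 a3 (a2 + a3 - 1) g23; rewrite /opE.
rewrite subrK (_ : m23 - (a2 + a3 - 1) = m23 - (a2 + a3) + 1); last by ring.
rewrite (_ : a2 - 1 + a3 = a2 + a3 - 1); last by ring.
rewrite (_ : a2 + (a3 - 1) = a2 + a3 - 1); last by ring.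
set X := q3j m1 m23 mu a1 (a2 + a3 - 1) a; set Y := q3j m2 m3 m23 a2 a3 (a2 + a3).
move=> e.
transitivity (qnum (m1 - a1 + 1) * qpow (2 * (a2 + a3))
    * (q3j m1 m23 mu (a1 - 1) (a2 + a3) a * Y)
  + X * (qnum (m23 - (a2 + a3) + 1) * Y)); last by ring.
by rewrite -e; ring.
Qed.

Lemma e12_F (m1 m2 m3 m12 mu a a1 a2 a3 : C) :
    verma_generic m12 -> verma_generic mu -> isnat (mu - a) ->
  opF3 m1 m2 m3 (e12 m1 m2 m3 m12 mu a) a1 a2 a3 =
  qnum (mu + a) * e12 m1 m2 m3 m12 mu (a - 1) a1 a2 a3.
Proof.
move=> g12 gmu ia; rewrite /opF3 !e12E [RHS]mulrA.
have := @q3j_F m12 m3 mu (a1 + a2) a3 a gmu ia; rewrite /opF => <-.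
rewrite (_ : a1 + 1 + a2 = a1 + a2 + 1); last by ring.
rewrite (_ : a1 + (a2 + 1) = a1 + a2 + 1); last by ring.
have [i12|n12] := boolP (isnat (m12 - (a1 + a2 + 1))); last first.
  rewrite (@q3j_out _ _ _ (a1 + a2 + 1)); last by rewrite (negbTE n12) !andbF.
  by ring.
have := @q3j_F m1 m2 m12 a1 a2 (a1 + a2 + 1) g12 i12; rewrite /opF.
rewrite addrK (_ : m12 + (a1 + a2 + 1) = m12 + (a1 + a2) + 1); last by ring.
set X := q3j m12 m3 mu (a1 + a2 + 1) a3 a; set Y := q3j m1 m2 m12 a1 a2 (a1 + a2).
move=> e.
transitivity (X * (qnum (m12 + (a1 + a2) + 1) * Y) + qpow (- (2 * (a1 + a2)))
   * qnum (m3 + a3 + 1) * (q3j m12 m3 mu (a1 + a2) (a3 + 1) a * Y)); last by ring.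
by rewrite -e; ring.
Qed.

Lemma e23_F (m1 m2 m3 m23 mu a a1 a2 a3 : C) :
    verma_generic m23 -> verma_generic mu -> isnat (mu - a) ->
  opF3 m1 m2 m3 (e23 m1 m2 m3 m23 mu a) a1 a2 a3 =
  qnum (mu + a) * e23 m1 m2 m3 m23 mu (a - 1) a1 a2 a3.
Proof.
move=> g23 gmu ia; rewrite /opF3 !e23E [RHS]mulrA.
have := @q3j_F m1 m23 mu a1 (a2 + a3) a gmu ia; rewrite /opF => <-.
rewrite (_ : a2 + 1 + a3 = a2 + a3 + 1); last by ring.
rewrite (_ : a2 + (a3 + 1) = a2 + a3 + 1); last by ring.
rewrite (_ : - (2 * (a1 + a2)) = - (2 * a1) + - (2 * a2)); last by ring.
rewrite qpowD.
have [i23|n23] := boolP (isnat (m23 - (a2 + a3 + 1))); last first.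
  rewrite (@q3j_out _ _ _ _ (a2 + a3 + 1)); last by rewrite (negbTE n23) !andbF.
  by ring.
have := @q3j_F m2 m3 m23 a2 a3 (a2 + a3 + 1) g23 i23; rewrite /opF.
rewrite addrK (_ : m23 + (a2 + a3 + 1) = m23 + (a2 + a3) + 1); last by ring.
set X := q3j m1 m23 mu a1 (a2 + a3 + 1) a; set Y := q3j m2 m3 m23 a2 a3 (a2 + a3).
move=> e; transitivity (qnum (m1 + a1 + 1) * (q3j m1 m23 mu (a1 + 1) (a2 + a3) a * Y)
   + qpow (- (2 * a1)) * X * (qnum (m23 + (a2 + a3) + 1) * Y)); last by ring.
by rewrite -e; ring.
Qed.

(** Induction on m3 - a3: the equation at (a1, a2, a3 + 1) expresses [m3 - a3] g(a1, a2, a3) through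
    values with third component a3 + 1. *)
Lemma singular_eq0 (m1 m2 m3 : C) (g : C -> C -> C -> C) :
    (forall a1 a2 a3, opE3 m1 m2 m3 g a1 a2 a3 = 0) ->
    (forall a1 a2 a3, ~~ isnat (m3 - a3) -> g a1 a2 a3 = 0) ->
    (forall a1 a2, g a1 a2 m3 = 0) ->
  forall a1 a2 a3, g a1 a2 a3 = 0.
Proof.
move=> sg supp g0 a1 a2 a3.
have [/isnatP [n]|] := boolP (isnat (m3 - a3)); last exact: supp.
elim: n a1 a2 a3 => [|n IH] a1 a2 a3 En.
  by move/eqP: En; rewrite subr_eq0 => /eqP <-.
have En' : m3 - (a3 + 1) = n%:R by rewrite opprD addrA En -natr1 addrK.
have := sg a1 a2 (a3 + 1); rewrite /opE3 addrK (IH (a1 - 1)) // (IH a1 (a2 - 1)) // !mulr0 !add0r.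
rewrite En' natr1 => /eqP; rewrite mulf_eq0 (negbTE (qnat n)).
by move/eqP.
Qed.

Definition generic3 (m1 m2 m3 : C) :=
  [/\ verma_generic m1, verma_generic m2, verma_generic m3,
      [/\ verma_generic (m1 + m2), verma_generic (m1 + m3)
        & verma_generic (m2 + m3)]
    & verma_generic (m1 + m2 + m3)].

Lemma generic3_rot (m1 m2 m3 : C) : generic3 m1 m2 m3 -> generic3 m3 m1 m2.
Proof.
move=> [g1 g2 g3 [g12 g13 g23] g]; split => //.
  by split; rewrite 1?(addrC m3).
by rewrite -addrA addrC.
Qed.

Lemma generic3_swap (m1 m2 m3 : C) : generic3 m1 m2 m3 -> generic3 m1 m3 m2.
Proof.
move=> [g1 g2 g3 [g12 g13 g23] g]; split => //; last by rewrite addrAC.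
by split; rewrite 1?(addrC m3).
Qed.

(** * Existence and uniqueness of the 6j-expansion *)

Section Expansion.
Variables (m1 m2 m3 mu : C) (N : nat).
Hypothesis gen : generic3 m1 m2 m3.
Hypothesis EN : m1 + m2 + m3 - mu = N%:R.

Let m23 (j : nat) : C := m2 + m3 - j%:R.

Lemma isnat_m23 (j : nat) : isnat (m2 + m3 - m23 j).
Proof. by rewrite /m23 subKr isnat_nat. Qed.

Lemma generic_mu : verma_generic mu.
Proof.
have [_ _ _ _ g] := gen.
have -> : mu = m1 + m2 + m3 - N%:R by rewrite -EN subKr.
exact: verma_generic_sub.
Qed.

Lemma generic_m23 (j : nat) : verma_generic (m23 j).
Proof. by have [_ _ _ [_ _ g] _] := gen; exact: verma_generic_sub. Qed.

Lemma e23_diag (a1 a2 a3 : C) (j : nat) :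
    isnat (m1 - a1) -> isnat (m2 - a2) -> isnat (m3 - a3) ->
    a1 + a2 + a3 = mu -> a2 + a3 = m23 j ->
  e23 m1 m2 m3 (m23 j) mu mu a1 a2 a3 != 0.
Proof.
move=> i1 i2 i3 Ea Ej; have [g1 g2 g3 [_ _ g23] g] := gen.
rewrite e23E Ej; apply: mulf_neq0; apply: q3j_top_neq0 => //.
- by rewrite subrr (isnat_nat R 0).
- by rewrite -Ej addrA.
- exact: generic_m23.
- by rewrite /m23 !addrA; exact: verma_generic_sub.
Qed.

(** The inner symbol requires [m23 j - m23 n] = n - j to be natural. With [e23_diag] this makes the
    coordinate matrix triangular. *)
Lemma e23_upper (a1 a2 a3 : C) (n j : nat) :
  a2 + a3 = m23 n -> (n < j)%N -> e23 m1 m2 m3 (m23 j) mu mu a1 a2 a3 = 0.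
Proof.
move=> En nj; rewrite e23E [X in _ * X]q3j_out ?mulr0 //.
apply/negP => /and5P [_ _ _ + _]; rewrite En /m23 opprB addrC addrA subrK.
case/isnatP => k /eqP; rewrite subr_eq -natrD eqr_nat; lia.
Qed.

(** The coordinates [a1 n], [a2 n] are chosen so that the total weight is mu and the last two
    weights add up to [m23 n], as triangularity requires. *)
Lemma e23_free_last (d : nat -> C) :
    (forall a1 a2, \sum_(j < N.+1) d j * e23 m1 m2 m3 (m23 j) mu mu a1 a2 m3 = 0) ->
  forall j, (j <= N)%N -> d j = 0.
Proof.
move=> d0; pose a1 n : C := m1 - (N - n)%:R; pose a2 n : C := m2 - n%:R.
have E n : a2 n + m3 = m23 n by rewrite /a2 /m23; ring.
apply: (@triangular_free _ N (fun n j => e23 m1 m2 m3 (m23 j) mu mu (a1 n) (a2 n) m3)).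
- move=> n nN; apply: e23_diag => //.
  + by rewrite /a1 subKr isnat_nat.
  + by rewrite /a2 subKr isnat_nat.
  + by rewrite subrr (isnat_nat R 0).
  + by rewrite /a1 /a2 natrB // -EN; ring.
- by move=> n j nj; exact: (e23_upper _ (E n)).
- by move=> n nN; exact: d0.
Qed.

(** The same independence seen on a2 = m2, the coordinates on which reversing the factors is
    explicit. *)
Lemma e23_free_middle (d : nat -> C) :
    (forall a1 a3, \sum_(j < N.+1) d j * e23 m1 m2 m3 (m23 j) mu mu a1 m2 a3 = 0) ->
  forall j, (j <= N)%N -> d j = 0.
Proof.
move=> d0; pose a1 n : C := m1 - (N - n)%:R; pose a3 n : C := m3 - n%:R.
have E n : m2 + a3 n = m23 n by rewrite /a3 /m23; ring.
apply: (@triangular_free _ N (fun n j => e23 m1 m2 m3 (m23 j) mu mu (a1 n) m2 (a3 n))).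
- move=> n nN; apply: e23_diag => //.
  + by rewrite /a1 subKr isnat_nat.
  + by rewrite subrr (isnat_nat R 0).
  + by rewrite /a3 subKr isnat_nat.
  + by rewrite /a1 /a3 natrB // -EN; ring.
- by move=> n j nj; exact: (e23_upper _ (E n)).
- by move=> n nN; exact: d0.
Qed.

Lemma adm23_sum (F : C -> C) :
  \sum_(x \in adm23 m1 m2 m3 mu) F x = \sum_(j < N.+1) F (m23 j).
Proof.
have -> : adm23 m1 m2 m3 mu = (m23 @` `I_N.+1)%classic.
  apply/seteqP; split => x /=.
    move=> [/isnatP [j Ej] /isnatP [k Ek]]; exists j; last by rewrite /m23 -Ej; ring.
    suff : (N = k + j)%N by lia.
    by apply/eqP; rewrite -(eqr_nat C) natrD -Ej -Ek -EN; apply/eqP; ring.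
  move=> [j jN <-]; split; first exact: isnat_m23.
  apply/isnatP; exists (N - j)%N; rewrite natrB; last by lia.
  by rewrite /m23 -EN; ring.
rewrite fsbig_image; first by rewrite -fsbig_ord.
move=> i j _ _ /(addrI (m2 + m3)) /oppr_inj /eqP.
by rewrite eqr_nat => /eqP.
Qed.

Variable m12 : C.
Hypothesis i12 : isnat (m1 + m2 - m12).

Lemma generic_m12 : verma_generic m12.
Proof.
have [_ _ _ [g _ _] _] := gen; have /isnatP [n En] := i12.
have -> : m12 = m1 + m2 - n%:R by rewrite -En subKr.
exact: verma_generic_sub.
Qed.

(* A singular vector is determined by its coordinates with a3 = m3, where the
   vectors e23 form a triangular system; lowering by F then reaches the other
   weights. *)
Lemma q6j_expansion_exists :
  exists c : C -> C, q6j_expansion h Delta m1 m2 m12 m3 mu c.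
Proof.
pose a1 n : C := m1 - (N - n)%:R; pose a2 n : C := m2 - n%:R.
have E n : a2 n + m3 = m23 n by rewrite /a2 /m23; ring.
have gmu := generic_mu; have g12 := generic_m12.
pose T n j := e23 m1 m2 m3 (m23 j) mu mu (a1 n) (a2 n) m3.
have Tdiag n : (n <= N)%N -> T n n != 0.
  move=> nN; apply: e23_diag => //.
  - by rewrite /a1 subKr isnat_nat.
  - by rewrite /a2 subKr isnat_nat.
  - by rewrite subrr (isnat_nat R 0).
  - by rewrite /a1 /a2 natrB // -EN; ring.
have Tupper n j : (n < j)%N -> T n j = 0 by exact: e23_upper (E n).
(* The coefficients are fixed by the coordinates of weight mu with a3 = m3; the rest of the proof
   propagates the identity. *)
have [c cP] := triangular_solve Tdiag Tupper
  (fun n => e12 m1 m2 m3 m12 mu mu (a1 n) (a2 n) m3).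
exists (fun x => c (natval (m2 + m3 - x))) => a ia b1 b2 b3.
rewrite adm23_sum; under eq_bigr do rewrite /m23 subKr natval_nat -/(m23 _).
case/isnatP: ia => k; elim: k a b1 b2 b3 => [|k IH] a b1 b2 b3 Ek.
  have <- : mu = a by apply/eqP; rewrite -subr_eq0 Ek.
  apply/eqP; rewrite -subr_eq0; apply/eqP.
  apply: (@singular_eq0 m1 m2 m3 (fun b1 b2 b3 => e12 m1 m2 m3 m12 mu mu b1 b2 b3 -
    \sum_(j < N.+1) c j * e23 m1 m2 m3 (m23 j) mu mu b1 b2 b3)).
  + move=> {}b1 {}b2 {}b3.
    transitivity (opE3 m1 m2 m3 (e12 m1 m2 m3 m12 mu mu) b1 b2 b3 -
      \sum_(j < N.+1) c j * opE3 m1 m2 m3 (e23 m1 m2 m3 (m23 j) mu mu) b1 b2 b3).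
      rewrite /opE3 !mulrBr !mulr_sumr.
      rewrite [X in _ = _ - X](_ : _ = \sum_(j < N.+1)
        (qnum (m1 - b1 + 1) * qpow (2 * (b2 + b3)) *
           (c j * e23 m1 m2 m3 (m23 j) mu mu (b1 - 1) b2 b3)
         + qnum (m2 - b2 + 1) * qpow (2 * b3) *
           (c j * e23 m1 m2 m3 (m23 j) mu mu b1 (b2 - 1) b3)
         + qnum (m3 - b3 + 1) *
           (c j * e23 m1 m2 m3 (m23 j) mu mu b1 b2 (b3 - 1)))).
        by rewrite !big_split /=; ring.
      by apply: eq_bigr => j _; ring.
    rewrite e12_E // subrr qnum0 mul0r sub0r big1 ?oppr0 // => j _.
    by rewrite e23_E ?subrr ?qnum0 ?mul0r ?mulr0 //; exact: generic_m23.
  + move=> {}b1 {}b2 {}b3 n3; rewrite e12E q3j_out ?mul0r; last first.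
      by rewrite (negbTE n3) !andbF.
    rewrite big1 ?subr0 // => j _; rewrite e23E [X in _ * (_ * X)]q3j_out ?mulr0 //.
    by rewrite (negbTE n3) !andbF.
  + move=> {}b1 {}b2; apply/eqP; rewrite subr_eq0; apply/eqP.
    have [/and3P[/isnatP [n1 E1] /isnatP [n2 E2] /eqP Eb]|H] :=
      boolP [&& isnat (m1 - b1), isnat (m2 - b2) & b1 + b2 + m3 == mu]; last first.
      rewrite /Defs.e12 /Defs.e23; case: ifPn => [/eqP Eb|_]; last first.
        by rewrite big1 // => j _; rewrite mulr0.
      have [n1|/negbTE n1] := boolP (isnat (m1 - b1)); last first.
        rewrite [X in _ * X]q3j_out ?mulr0; last by rewrite n1 !andbF.
        by rewrite big1 // => j _; rewrite q3j_out ?mul0r ?mulr0 // n1 !andbF.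
      have [n2|/negbTE n2] := boolP (isnat (m2 - b2)); last first.
        rewrite [X in _ * X]q3j_out ?mulr0; last by rewrite n2 !andbF.
        rewrite big1 // => j _; rewrite [X in _ * (_ * X)]q3j_out ?mulr0 //.
        by rewrite n2 !andbF.
      by case/negP: H; rewrite n1 n2 Eb eqxx.
    (* Every weight of the support with a3 = m3 is one of the [N.+1] rows already solved. *)
    have EnN : N = (n1 + n2)%N.
      by apply/eqP; rewrite -(eqr_nat C) natrD -E1 -E2 -EN -Eb; apply/eqP; ring.
    have -> : b1 = a1 n2 by rewrite /a1 EnN addnK -E1 subKr.
    have -> : b2 = a2 n2 by rewrite /a2 -E2 subKr.
    by rewrite -cP // EnN leq_addl.
have Ek' : mu - (a + 1) = k%:R by rewrite opprD addrA Ek -natr1 addrK.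
have ik : isnat (mu - (a + 1)) by rewrite Ek' isnat_nat.
have nz : qnum (mu + (a + 1)) != 0.
  by rewrite (_ : _ + _ = 2 * mu - k%:R) // -Ek'; ring.
apply: (mulfI nz).
have := @e12_F m1 m2 m3 m12 mu (a + 1) b1 b2 b3 g12 gmu ik.
rewrite addrK mulr_sumr => <-.
rewrite /opF3 !IH // !mulr_sumr -!big_split; apply: eq_bigr => j _ /=.
have := @e23_F m1 m2 m3 (m23 j) mu (a + 1) b1 b2 b3 (generic_m23 j) gmu ik.
by rewrite addrK => e; rewrite [RHS]mulrCA -e /opF3; ring.
Qed.

(** [q6j] chooses an expansion separately for each value of its last argument; by [e23_free_last]
    all expansions agree on the admissible weights, so the chosen values fit together. *)
Lemma q6jP (a1 a2 a3 : C) :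
  e12 m1 m2 m3 m12 mu mu a1 a2 a3 =
  \sum_(j < N.+1) q6j m1 m2 m12 m3 mu (m2 + m3 - j%:R)
                  * e23 m1 m2 m3 (m2 + m3 - j%:R) mu mu a1 a2 a3.
Proof.
have mu0 : isnat (mu - mu) by rewrite subrr (isnat_nat R 0).
have [c cP] := q6j_expansion_exists.
rewrite cP // adm23_sum; apply: eq_bigr => j _; rewrite -/(m23 j); congr (_ * _); rewrite /Defs.q6j.
have [|c' c'P ->] := @xgetPex _ 0 [set s | exists2 c : C -> C,
    q6j_expansion h Delta m1 m2 m12 m3 mu c & s = c (m23 j)]%classic.
  by exists (c (m23 j)); exists c.
have jN : (j <= N)%N by rewrite -ltnS.
apply/eqP; rewrite -subr_eq0; apply/eqP.
apply: (@e23_free_last (fun j => c (m23 j) - c' (m23 j))) => // b1 b2.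
under eq_bigr do rewrite mulrBl.
rewrite sumrB -!(adm23_sum (fun x => _ x * e23 m1 m2 m3 x mu mu b1 b2 m3)).
by rewrite -cP // -c'P // subrr.
Qed.

End Expansion.

(** * Moving and reversing tensor factors; relations between 6j-symbols *)

Lemma e12_rot (m1 m2 m3 m12 mu a1 a2 : C) :
  e12 m1 m2 m3 m12 mu mu a1 a2 m3 =
  braid_phase m12 m3 mu * qpow (- (2 * (a1 + a2) * m3))
  * e23 m3 m1 m2 m12 mu mu m3 a1 a2.
Proof. by rewrite e12E e23E q3j_braid // !mulrA. Qed.

Lemma e23_swap (m1 m2 m3 m23 mu a1 a2 : C) :
  e23 m1 m2 m3 m23 mu mu a1 a2 m3 =
  braid_phase m2 m3 m23 * qpow (- (2 * a2 * m3))
  * e23 m1 m3 m2 m23 mu mu a1 m3 a2.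
Proof. by rewrite !e23E q3j_braid // (addrC a2); ring. Qed.

Lemma e12_swap (m1 m2 m3 m12 mu a1 a3 : C) :
  e12 m1 m2 m3 m12 mu mu a1 m2 a3 =
  braid_phase m1 m2 m12 * qpow (- (2 * a1 * m2))
  * e12 m2 m1 m3 m12 mu mu m2 a1 a3.
Proof. by rewrite !e12E q3j_braid // (addrC a1); ring. Qed.

(* All vectors are compared at a3 = m3, where m3 can be moved to the front either
   in one step (e12_rot) or past m2 and then m1 (e23_swap, e12_swap). *)
Lemma q6j_braid (m1 m2 m3 mu m13 : C) (N j : nat) :
    generic3 m1 m2 m3 -> m1 + m2 + m3 - mu = N%:R ->
    isnat (m1 + m3 - m13) -> (j <= N)%N ->
  \sum_(i < N.+1) q6j m3 m1 m13 m2 mu (m1 + m2 - i%:R)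
     / braid_phase (m1 + m2 - i%:R) m3 mu
     * q6j m1 m2 (m1 + m2 - i%:R) m3 mu (m2 + m3 - j%:R) =
  (braid_phase m1 m3 m13 * braid_phase m2 m3 (m2 + m3 - j%:R))^-1
  * q6j m1 m3 m13 m2 mu (m2 + m3 - j%:R).
Proof.
move=> gen EN i13 jN; apply/eqP; rewrite -subr_eq0; apply/eqP.
pose d j : C := \sum_(i < N.+1) q6j m3 m1 m13 m2 mu (m1 + m2 - i%:R)
     / braid_phase (m1 + m2 - i%:R) m3 mu
     * q6j m1 m2 (m1 + m2 - i%:R) m3 mu (m2 + m3 - j%:R) -
  (braid_phase m1 m3 m13 * braid_phase m2 m3 (m2 + m3 - j%:R))^-1
  * q6j m1 m3 m13 m2 mu (m2 + m3 - j%:R).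
apply: (@e23_free_last _ _ _ _ _ gen EN d) => // b1 b2.
have gen312 := generic3_rot gen; have gen132 := generic3_swap gen.
have EN312 : m3 + m1 + m2 - mu = N%:R by rewrite -EN; ring.
have EN132 : m1 + m3 + m2 - mu = N%:R by rewrite -EN; ring.
have i31 : isnat (m3 + m1 - m13) by rewrite (addrC m3).
have e312 := q6jP gen312 EN312 i31 m3 b1 b2.
have e132 := q6jP gen132 EN132 i13 b1 m3 b2.
rewrite (addrC m3 m2) in e132.
set c := qpow (- (2 * (b1 + b2) * m3)).
have cE : qpow (- (2 * b1 * m3)) * qpow (- (2 * b2 * m3)) = c.
  by rewrite -qpowD; congr (Defs.qpow h _); ring.
rewrite /d; under eq_bigr do rewrite mulrBl mulr_suml.
rewrite sumrB exchange_big /=.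
(* One-step route: summing over [j] gives the vectors [e12] of (1, 2, 3), [e12_rot] cancels the
   phases, and the sum over [i] is the expansion for (3, 1, 2). *)
rewrite [X in X - _](_ : _ = c * e12 m3 m1 m2 m13 mu mu m3 b1 b2); last first.
  rewrite e312 mulr_sumr; apply: eq_bigr => i _.
  have i12 : isnat (m1 + m2 - (m1 + m2 - i%:R)) by rewrite subKr isnat_nat.
  have e123 := q6jP gen EN i12 b1 b2 m3.
  under eq_bigr do rewrite -[_ * e23 _ _ _ _ _ _ _ _ _]mulrA.
  rewrite -mulr_sumr -e123 e12_rot -/c.
  have := braid_phase_neq0 (m1 + m2 - i%:R) m3 mu.
  by move=> p0; field.
rewrite [X in _ - X](_ : _ = c * e12 m3 m1 m2 m13 mu mu m3 b1 b2) ?subrr //.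
have p13 := braid_phase_neq0 m1 m3 m13.
(* Two-step route: exchange 3 with 1, expand for (1, 3, 2), then exchange 3 with 2. *)
have -> : c * e12 m3 m1 m2 m13 mu mu m3 b1 b2 = (braid_phase m1 m3 m13)^-1
    * qpow (- (2 * b2 * m3)) * e12 m1 m3 m2 m13 mu mu b1 m3 b2.
  by rewrite e12_swap -cE; field.
rewrite e132 mulr_sumr; apply: eq_bigr => k _.
have p23 := braid_phase_neq0 m2 m3 (m2 + m3 - k%:R).
by rewrite e23_swap; field; rewrite p13 p23.
Qed.

(* On vectors with a2 = m2 the half twist 123 -> 321 acts by a scalar that does
   not depend on m12. *)
Lemma e23_rev (m1 m2 m3 m12 mu a1 a3 : C) (N : nat) :
    m1 + m2 + m3 - mu = N%:R ->
    isnat (m1 + m2 - m12) -> isnat (m12 + m3 - mu) ->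
  e23 m3 m2 m1 m12 mu mu a3 m2 a1 =
  (-1) ^+ N * qpow (casimir m1 - casimir m3 + casimir a3 - casimir a1)
  * e12 m1 m2 m3 m12 mu mu a1 m2 a3.
Proof.
move=> EN /isnatP [J EJ] /isnatP [K EK].
have NE : N = (J + K)%N.
  by apply/eqP; rewrite -(eqr_nat C) natrD -EJ -EK -EN; apply/eqP; ring.
rewrite e12E e23E q3j_top_flip // (q3j_braid m1 m2) //.
rewrite /braid_phase EJ (addrC m3 m12) EK !natval_nat (addrC m2 a1).
have sgnJ : (-1) ^+ J * (-1) ^+ J = 1 :> C by rewrite -exprMn mulrNN mulr1 expr1n.
have -> : qpow (casimir m12 - casimir m3 + casimir a3 - casimir (a1 + m2)) =
  qpow (casimir m1 - casimir m3 + casimir a3 - casimir a1)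
  * qpow (casimir m12 - casimir m1 - casimir m2) * qpow (- (2 * a1 * m2)).
  by rewrite -!qpowD /casimir; congr (Defs.qpow h _); ring.
rewrite NE exprD; set s := (-1) ^+ J in sgnJ *; set t := (-1) ^+ K.
set X := q3j m12 _ _ _ _ _; set Y := q3j m2 _ _ _ _ _.
set A := qpow _; set B := qpow _; set D := qpow _.
transitivity (t * (A * B * D) * X * Y * 1); first by ring.
by rewrite -sgnJ; ring.
Qed.

(** Reverse the factors with [e23_rev], expand for (1, 2, 3), reverse each term back and expand for
    (3, 2, 1). The two reversal scalars are mutually inverse, so the original vector reappears and
    coefficients can be compared. *)
Lemma q6j_inv (m1 m2 m3 mu : C) (N i k : nat) :
    generic3 m1 m2 m3 -> m1 + m2 + m3 - mu = N%:R ->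
    (i <= N)%N -> (k <= N)%N ->
  \sum_(j < N.+1) q6j m1 m2 (m1 + m2 - i%:R) m3 mu (m2 + m3 - j%:R)
     * q6j m3 m2 (m2 + m3 - j%:R) m1 mu (m1 + m2 - k%:R) = (i == k)%:R.
Proof.
move=> gen EN iN kN.
(* Written with m2 + m1, the form in which [e23_free_middle] for (3, 2, 1) indexes its vectors. *)
pose d k : C :=
  \sum_(j < N.+1) q6j m1 m2 (m1 + m2 - i%:R) m3 mu (m2 + m3 - j%:R)
     * q6j m3 m2 (m2 + m3 - j%:R) m1 mu (m2 + m1 - k%:R) - (i == k)%:R.
apply/eqP; rewrite -subr_eq0 (addrC m1 m2); apply/eqP.
have gen321 : generic3 m3 m2 m1 by do 2!apply: generic3_rot; exact: generic3_swap.
have EN321 : m3 + m2 + m1 - mu = N%:R by rewrite -EN; ring.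
rewrite -[LHS]/(\sum_(j < N.+1) q6j m1 m2 (m2 + m1 - i%:R) m3 mu (m2 + m3 - j%:R)
     * q6j m3 m2 (m2 + m3 - j%:R) m1 mu (m2 + m1 - k%:R) - (i == k)%:R).
rewrite [in X in q6j m1 m2 X](addrC m2 m1).
apply: (@e23_free_middle _ _ _ _ _ gen321 EN321 d) => // b3 b1.
rewrite /d; under eq_bigr do rewrite mulrBl mulr_suml.
rewrite sumrB exchange_big /=.
have nat12 n : isnat (m1 + m2 - (m2 + m1 - n%:R)).
  by rewrite (addrC m1) subKr isnat_nat.
have nat23 n : isnat (m3 + m2 - (m2 + m3 - n%:R)).
  by rewrite (addrC m3) subKr isnat_nat.
have nat12_3 n : (n <= N)%N -> isnat (m2 + m1 - n%:R + m3 - mu).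
  by move=> nN; apply/isnatP; exists (N - n)%N; rewrite natrB // -EN; ring.
have nat23_1 n : (n <= N)%N -> isnat (m2 + m3 - n%:R + m1 - mu).
  by move=> nN; apply/isnatP; exists (N - n)%N; rewrite natrB // -EN; ring.
rewrite [X in _ - X](_ : _ = e23 m3 m2 m1 (m2 + m1 - i%:R) mu mu b3 m2 b1); last first.
  rewrite (bigD1 (Ordinal (iN : (i < N.+1)%N))) //= eqxx mul1r big1 ?addr0 // => j.
  by rewrite -val_eqE /= eq_sym => /negbTE ->; rewrite mul0r.
rewrite (e23_rev _ _ EN (nat12 i) (nat12_3 i iN)).
have i12 : isnat (m1 + m2 - (m1 + m2 - i%:R)) by rewrite subKr isnat_nat.
rewrite (addrC m2 m1) (q6jP gen EN i12) mulr_sumr -sumrB big1 // => j _.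
have jN : (j <= N)%N by rewrite -ltnS.
rewrite (e23_rev b3 b1 EN321 (nat23 j) (nat23_1 j jN)).
rewrite (q6jP gen321 EN321 (nat23 j)) (addrC m2 m1).
under eq_bigr do rewrite -[_ * e23 _ _ _ _ _ _ _ _ _]mulrA.
rewrite -mulr_sumr.
set S := \sum_(_ < _) _.
have sgnN : (-1) ^+ N * (-1) ^+ N = 1 :> C by rewrite -exprMn mulrNN mulr1 expr1n.
have qq : qpow (casimir m1 - casimir m3 + casimir b3 - casimir b1)
    * qpow (casimir m3 - casimir m1 + casimir b1 - casimir b3) = 1.
  by rewrite -qpowD -qpow0; congr (Defs.qpow h _); ring.
set s := (-1) ^+ N in sgnN *; set x := qpow _ in qq *; set y := qpow _ in qq *.
set q := q6j _ _ _ _ _ _.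
transitivity (q * S - q * S * (s * s) * (x * y)); first by ring.
by rewrite sgnN qq; ring.
Qed.

(** [q6j_braid] for (1, 3, 2) rewrites each 6j-symbol divided by its phase as a sum over [i];
    contracting with the inverse matrix from [q6j_inv] for (3, 1, 2) leaves the term [i] = [p]. *)
Lemma q6j_racah (m1 m2 m3 mu : C) (N p r : nat) :
    generic3 m1 m2 m3 -> m1 + m2 + m3 - mu = N%:R ->
    (p <= N)%N -> (r <= N)%N ->
  \sum_(j < N.+1) q6j m3 m1 (m1 + m3 - p%:R) m2 mu (m1 + m2 - j%:R)
     / braid_phase m1 m2 (m1 + m2 - j%:R)
     * q6j m1 m2 (m1 + m2 - j%:R) m3 mu (m2 + m3 - r%:R) =
  braid_phase m2 m3 (m2 + m3 - r%:R) / braid_phase (m1 + m3 - p%:R) m2 mu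
  * q6j m1 m3 (m1 + m3 - p%:R) m2 mu (m2 + m3 - r%:R).
Proof.
move=> gen EN pN rN.
have gen132 := generic3_swap gen; have gen312 := generic3_rot gen.
have EN312 : m3 + m1 + m2 - mu = N%:R by rewrite -EN; ring.
have EN132 : m1 + m3 + m2 - mu = N%:R by rewrite -EN; ring.
pose P := braid_phase m2 m3 (m2 + m3 - r%:R).
transitivity (\sum_(j < N.+1) q6j m3 m1 (m1 + m3 - p%:R) m2 mu (m1 + m2 - j%:R) * P
    * \sum_(i < N.+1) q6j m2 m1 (m1 + m2 - j%:R) m3 mu (m1 + m3 - i%:R)
     / braid_phase (m1 + m3 - i%:R) m2 mu
     * q6j m1 m3 (m1 + m3 - i%:R) m2 mu (m2 + m3 - r%:R)).
  apply: eq_bigr => j _.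
  have i12 : isnat (m1 + m2 - (m1 + m2 - j%:R)) by rewrite subKr isnat_nat.
  have := q6j_braid gen132 EN132 i12 rN; rewrite (addrC m3 m2) => ->.
  rewrite (braid_phaseC m3 m2) -/P.
  have P0 : P != 0 := braid_phase_neq0 _ _ _.
  have p12 := braid_phase_neq0 m1 m2 (m1 + m2 - j%:R).
  by field; rewrite P0 p12.
under eq_bigr do rewrite mulr_sumr.
rewrite exchange_big /=.
rewrite (bigD1 (Ordinal (pN : (p < N.+1)%N))) //= [X in _ + X]big1 ?addr0.
  transitivity ((p == p)%:R * (P / braid_phase (m1 + m3 - p%:R) m2 mu
    * q6j m1 m3 (m1 + m3 - p%:R) m2 mu (m2 + m3 - r%:R))); last by rewrite eqxx mul1r.
  rewrite -(q6j_inv gen312 EN312 pN pN) mulr_suml; apply: eq_bigr => j _.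
  by rewrite (addrC m3 m1); ring.
move=> i; rewrite -val_eqE /= eq_sym => /negbTE ne.
have iN : (i <= N)%N by rewrite -ltnS.
transitivity ((p == i)%:R * (P / braid_phase (m1 + m3 - i%:R) m2 mu
    * q6j m1 m3 (m1 + m3 - i%:R) m2 mu (m2 + m3 - r%:R))); last by rewrite ne mul0r.
rewrite -(q6j_inv gen312 EN312 pN iN) mulr_suml; apply: eq_bigr => j _.
by rewrite (addrC m3 m1); ring.
Qed.

(** * From the genericity hypotheses to the Racah relation *)

Lemma q_generic_neq0 (l1 l2 l3 x : C) (n n1 n2 n3 : int) :
    q_generic h l1 l2 l3 ->
    x = n%:~R + 2 * n1%:~R * l1 + 2 * n2%:~R * l2 + 2 * n3%:~R * l3 ->
  x != 0 -> qnum x != 0.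
Proof. by move=> hq ->; exact: hq. Qed.

(** [q_generic] only controls nonzero arguments; excluding half-naturals gives 2x - k nonzero. The
    booleans encode the subset whose weights are added. *)
Lemma verma_genericP (l1 l2 l3 x : C) (b1 b2 b3 : bool) :
    q_generic h l1 l2 l3 -> ~ half_nat x -> x = b1%:R * l1 + b2%:R * l2 + b3%:R * l3 ->
  verma_generic x.
Proof.
move=> hq hx Ex k; apply: (q_generic_neq0 (n := - k%:Z) (n1 := b1) (n2 := b2)
  (n3 := b3) hq).
  by rewrite rmorphN /= -!pmulrn Ex; ring.
apply/eqP => /eqP; rewrite subr_eq0 => /eqP xk; apply: hx; exists k.
by rewrite -xk; field.
Qed.

Lemma generic3_of (l1 l2 l3 : C) : q_generic h l1 l2 l3 ->
    (forall I : {set 'I_3}, I != finset.set0 ->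
       ~ half_nat (\sum_(i in I) tnth [tuple l1; l2; l3] i)) ->
  generic3 l1 l2 l3.
Proof.
move=> hq hl.
have g (b1 b2 b3 : bool) : b1 || b2 || b3 ->
    verma_generic (b1%:R * l1 + b2%:R * l2 + b3%:R * l3).
  move=> b; pose I := finset (fun i : 'I_3 => nth false [:: b1; b2; b3] i).
  have I0 : I != finset.set0.
    apply/set0Pn; move: b; case: b1 @I => /=; first by exists 0; rewrite inE.
    case: b2 => /=; first by exists 1; rewrite inE.
    by case: b3 => //= _; exists 2; rewrite inE.
  apply: (verma_genericP hq _ erefl); move: (hl I I0).
  rewrite big_mkcond !big_ord_recl big_ord0 /= !inE /= !(tnth_nth 0) /= addr0 addrA.
  by case: b1 b2 b3 {b I I0} => [] [] [] /=; rewrite ?mul1r ?mul0r.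
split.
- by have := g true false false isT; rewrite !mul0r mul1r !addr0.
- by have := g false true false isT; rewrite !mul0r mul1r addr0 add0r.
- by have := g false false true isT; rewrite !mul0r mul1r !add0r.
- split.
  + by have := g true true false isT; rewrite mul0r !mul1r addr0.
  + by have := g true false true isT; rewrite mul0r !mul1r addr0.
  + by have := g false true true isT; rewrite mul0r !mul1r add0r.
- by have := g true true true isT; rewrite !mul1r.
Qed.

End Racah.

Theorem theorem6p4 (R : realType) (h : R[i])
    (Delta : R[i] -> R[i] -> R[i] -> R[i])
    (l1 l2 l3 l13 l23 l123 : R[i])
    (hDelta : triangle_root h Delta)
    (hq : q_generic h l1 l2 l3)
    (hl : forall I : {set 'I_3}, I != finset.set0 ->
            ~ half_nat (\sum_(i in I) tnth [tuple l1; l2; l3] i))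
    (h13 : isnat (l1 + l3 - l13))
    (h23 : isnat (l2 + l3 - l23))
    (h13_2 : isnat (l13 + l2 - l123))
    (h1_23 : isnat (l1 + l23 - l123)) :
  \sum_(0 <= j < (natval (l1 + l2 + l3 - l123)).+1)
    (let alpha := l1 + l2 - j%:R in
     m1pow alpha * qpow h (- (alpha * (alpha + 1)))
     * q6j h Delta l1 l2 alpha l3 l123 l23
     * q6j h Delta l3 l1 l13 l2 l123 alpha)
  = m1pow (l1 + l2 + l3 + l123 - l13 - l23)
    * qpow h (casimir l13 + casimir l23 - casimir l1 - casimir l2
              - casimir l3 - casimir l123)
    * q6j h Delta l1 l3 l13 l2 l123 l23.
Proof.
have gen := generic3_of hq hl.
have qnat (n : nat) : qnum h n.+1%:R != 0.
  apply: (q_generic_neq0 (n := n.+1) (n1 := 0) (n2 := 0) (n3 := 0) hq).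
    by rewrite -pmulrn; ring.
  by rewrite pnatr_eq0.
have [[p Ep] [r Er]] := (isnatP _ h13, isnatP _ h23).
have [[p' Ep'] [r' Er']] := (isnatP _ h13_2, isnatP _ h1_23).
pose N := (p + p')%N.
have EN : l1 + l2 + l3 - l123 = N%:R by rewrite natrD -Ep -Ep'; ring.
have Nr : N = (r + r')%N.
  by apply/eqP; rewrite -(eqr_nat R[i]) natrD -Er -Er' -EN; apply/eqP; ring.
have E13 : l13 = l1 + l3 - p%:R by rewrite -Ep subKr.
have E23 : l23 = l2 + l3 - r%:R by rewrite -Er subKr.
have pN : (p <= N)%N by rewrite leq_addr.
have rN : (r <= N)%N by rewrite Nr leq_addr.
have := q6j_racah qnat hDelta gen EN pN rN; rewrite -E13 -E23 => racah.
rewrite EN natval_nat big_mkord.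
(* The part of (-1)^alpha q^(-alpha (alpha + 1)) independent of alpha: the whole factor is [c] over
   the braiding phase of (l1, l2, alpha). *)
pose c := m1pow (l1 + l2) * qpow h (- casimir l1 - casimir l2).
have sgn2 (n : nat) : (-1) ^+ n * (-1) ^+ n = 1 :> R[i].
  by rewrite -exprMn mulrNN mulr1 expr1n.
transitivity (c * \sum_(j < N.+1) q6j h Delta l3 l1 l13 l2 l123 (l1 + l2 - j%:R)
     / braid_phase h l1 l2 (l1 + l2 - j%:R)
     * q6j h Delta l1 l2 (l1 + l2 - j%:R) l3 l123 l23).
  rewrite mulr_sumr; apply: eq_bigr => j _ /=.
  set al := l1 + l2 - j%:R.
  suff -> : m1pow al * qpow h (- (al * (al + 1))) = c / braid_phase h l1 l2 al by ring.
  apply: (mulIf (braid_phase_neq0 h l1 l2 al)); rewrite divfK ?braid_phase_neq0 //.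
  rewrite /braid_phase /al subKr natval_nat -/al /c.
  have -> : m1pow (l1 + l2) = m1pow al * (-1) ^+ j.
    by rewrite -m1pow_nat -m1powD subrK.
  have -> : qpow h (- casimir l1 - casimir l2) =
      qpow h (- (al * (al + 1))) * qpow h (casimir al - casimir l1 - casimir l2).
    by rewrite -qpowD /casimir; congr (qpow h _); ring.
  by ring.
rewrite racah mulrA; congr (_ * _).
apply: (mulIf (braid_phase_neq0 h l13 l2 l123)).
rewrite mulrA divfK ?braid_phase_neq0 // /braid_phase Er Ep' !natval_nat /c.
rewrite [RHS]mulrACA.
have -> : m1pow (l1 + l2 + l3 + l123 - l13 - l23) * (-1) ^+ p' = m1pow (l1 + l2) * (-1) ^+ r.
  rewrite -!m1pow_nat -!m1powD -Er -Ep'; congr m1pow; ring.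
have e : qpow h (- casimir l1 - casimir l2) * qpow h (casimir l23 - casimir l2 - casimir l3)
  = qpow h (casimir l13 + casimir l23 - casimir l1 - casimir l2 - casimir l3 - casimir l123)
    * qpow h (casimir l123 - casimir l13 - casimir l2).
  by rewrite -!qpowD; congr (qpow h _); ring.
by rewrite -e [RHS]mulrACA.
Qed.
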